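(* Suppose $\tau<\frac{n}{10}$. Let $$a^*(\tau):=\frac{1}{32\,(1+\tau\sqrt{\Delta})\,\xi(\kappa,\Delta,\tau)},\qquad \xi(\kappa,\Delta,\tau):=\sqrt{1+\frac{1}{8\kappa}\min\Big\{\frac{1}{\sqrt{\Delta}},\tau\Big\}}.$$ For any step size $\gamma=\frac{a}{L}$ with $0<a\le a^*(\tau)$, the inconsistent read iterates $\hat x_t$ of ASAGA converge in expectation at a geometric rate of at least $\rho(a)=\frac15\min\{\frac1n,\frac{a}{\kappa}\}$; that is, for all $t\ge0$, $$\mathbb{E} f(\hat x_t)-f(x^* )\le(1-\rho)^t\,\tilde C_0,$$ where $\rho=\rho(a)$ and $\tilde C_0$ is a constant independent of $t$, of order $\frac{n}{\gamma}C_0$ (i.e. at most a universal constant times $\frac n\gamma C_0$), with $C_0:=\|x_0-x^*\|^2+\frac{1}{5L^2}\sum_{i=1}^n\|\alpha_i^0-f_i'(x^* )\|^2$.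
   Context: Let $f(x)=\frac1n\sum_{i=1}^n f_i(x)$ on $\mathbb{R}^d$, where each $f_i$ is convex and differentiable with $L$-Lipschitz gradient $f_i'$, and $f$ is $\mu$-strongly convex ($\mu>0$). Let $\kappa:=L/\mu$ and let $x^*$ be the minimizer of $f$. $[x]_v$ denotes coordinate $v$ of $x$. For each $i$, $S_i\subseteq\{1,\dots,d\}$ is the support of $f_i'$, i.e. the set of coordinates where $f_i'$ can be nonzero. $P_{S_i}$ is the coordinate projection onto $S_i$; $p_v:=\frac1n|\{i:v\in S_i\}|$; $D$ is diagonal with entries $1/p_v$; $D_i:=P_{S_i}D$. The sparsity constant is $\Delta:=\frac1n\max_{v}|\{i:v\in S_i\}|\in[\frac1n,1]$. ASAGA (asynchronous parallel algorithm, step size $\gamma$). Shared memory holds $x\in\mathbb{R}^d$, initialized at deterministic $x_0$, and $(\alpha_i)_{i=1}^n$, initialized at deterministic $\alpha_i^0$ with support in $S_i$. Several cores repeat in parallel, without locks: (1) read all coordinates of $x$ and of all $\alpha_j$ into local copies $\hat x,\hat\alpha_j$ (possibly inconsistently: coordinates are read at different times while other cores write); (2) sample $i$ uniformly in $\{1,\dots,n\}$; (3) compute $g=f_i'(\hat x)-\hat\alpha_i+D_i\big(\frac1n\sum_{k=1}^n\hat\alpha_k\big)$; (4) for each $v\in S_i$, atomically do $[x]_v\leftarrow[x]_v-\gamma[g]_v$, and write $[\alpha_i]_v\leftarrow[f_i'(\hat x)]_v$. Labeling (''after read''): iterations are labeled $t=0,1,2,\dots$ in the order in which their reads are completed; $\hat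 x_t,\hat\alpha^t$ are the values read, $i_t$ the index sampled and $g_t:=f_{i_t}'(\hat x_t)-\hat\alpha_{i_t}^t+D_{i_t}\big(\frac1n\sum_k\hat\alpha_k^t\big)$ the direction computed by iteration $t$. Independence: $i_t$ is uniform on $\{1,\dots,n\}$ and independent of everything in the past of the completed read $t$, i.e. of all reads $\hat x_u,\hat\alpha^u$ with $u\le t$ and of all $i_u$ with $u<t$ (in particular $i_r$ is independent of $\hat x_t$ for $r\ge t$). Bounded overlap assumption with constant $\tau\ge0$ (integer): an iteration is being processed from the start of its read to the end of its writes, and iterations $r$ and $t$ are never processed concurrently when $r\ge t+\tau+1$; thus all coordinate writes of iteration $t$ are in memory before iteration $t+\tau+1$ starts. Hence, with virtual iterates defined by $x_{t+1}:=x_t-\gamma g_t$ (starting from $x_0$), one has $\hat x_t-x_t=\gamma\sum_{u=(t-\tau)_+}^{t-1}G_u^t g_u$, where the $G_u^t$ are (random) $d\times d$ diagonal matrices with entries in $\{0,1\}$ (entry $1$ meaning that this coordinate write of iteration $u$ was not yet in memory when read by iteration $t$). Similarly each $[\hat\alpha_i^t]_v$ is the most recently written value in memory when read: it equals either $[\alpha_i^0]_v$, which for $v\in S_i$ is only possible if $i_w\ne i$ for all $0\le w\le t-\tau-1$, or $[f_i'(\hat x_u)]_v$ for some $u<t$ with $i_u=i$ and $i_w\neq i$ for all $u+\tau+1\le w\le t-\tau-1$. *)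

(* Defs.v *)
From HB Require Import structures.
From mathcomp Require Import all_boot all_order all_algebra.
From mathcomp Require Import all_classical all_reals all_analysis.

Set Implicit Arguments.
Unset Strict Implicit.
Unset Printing Implicit Defensive.

Import Order.TTheory GRing.Theory Num.Theory.
Import numFieldNormedType.Exports.

Local Open Scope classical_set_scope.
Local Open Scope ring_scope.

(* The library norm `|x| on 'rV[R]_d is the sup norm, hence this definition.  *)
Definition enorm (R : realType) (d : nat) (x : 'rV[R]_d) : R :=
  Num.sqrt (\sum_v x 0 v ^+ 2).

(* Meaningful where h is differentiable; differentiability is always assumed
   separately. *)
Definition grad (R : realType) (d : nat) (h : 'rV[R]_d -> R) (x : 'rV[R]_d) :
    'rV[R]_d :=
  \row_v 'D_(delta_mx 0 v) h x.

Definition lipschitz_grad (R : realType) (d : nat) (L : R)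
    (h : 'rV[R]_d -> R) : Prop :=
  forall x y, enorm (grad h x - grad h y) <= L * enorm (x - y).

Definition strongly_convex (R : realType) (d : nat) (mu : R)
    (h : 'rV[R]_d -> R) : Prop :=
  forall (l : R) x y, 0 <= l <= 1 ->
    h (l *: x + (1 - l) *: y) <=
    l * h x + (1 - l) * h y - mu / 2 * l * (1 - l) * enorm (x - y) ^+ 2.

Definition fmean (R : realType) (d n : nat) (f : 'I_n -> 'rV[R]_d -> R)
    (x : 'rV[R]_d) : R :=
  n%:R^-1 * \sum_i f i x.

Definition supp (R : realType) (d n : nat) (f : 'I_n -> 'rV[R]_d -> R)
    (i : 'I_n) : {set 'I_d} :=
  [set v | `[< exists x, grad (f i) x 0 v != 0 >]]%SET.

Definition occ (R : realType) (d n : nat) (f : 'I_n -> 'rV[R]_d -> R)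
    (v : 'I_d) : nat :=
  #|[set i | v \in supp f i]%SET|.

Definition pv (R : realType) (d n : nat) (f : 'I_n -> 'rV[R]_d -> R)
    (v : 'I_d) : R :=
  n%:R^-1 * (occ f v)%:R.

Definition Delta (R : realType) (d n : nat) (f : 'I_n -> 'rV[R]_d -> R) : R :=
  n%:R^-1 * (\max_v occ f v)%:R.

Definition Dmx (R : realType) (d n : nat) (f : 'I_n -> 'rV[R]_d -> R) :
    'M[R]_d :=
  diag_mx (\row_v (pv f v)^-1).

Definition projmx (R : realType) (d : nat) (S : {set 'I_d}) : 'M[R]_d :=
  diag_mx (\row_v (v \in S)%:R).

Definition Dimx (R : realType) (d n : nat) (f : 'I_n -> 'rV[R]_d -> R)
    (i : 'I_n) : 'M[R]_d :=
  projmx R (supp f i) *m Dmx f.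

(* Vectors are rows, so the (diagonal) matrix D_i acts from the right. *)
Definition asaga_dir (R : realType) (d n : nat) (f : 'I_n -> 'rV[R]_d -> R)
    (xh : 'rV[R]_d) (ah : 'I_n -> 'rV[R]_d) (i : 'I_n) : 'rV[R]_d :=
  grad (f i) xh - ah i + (n%:R^-1 *: \sum_k ah k) *m Dimx f i.

(* Time stamps of the events of one run, indexed by the iteration label:
   iteration t is processed during [start t, finish t], reads coordinate v of x
   at time xread t v and coordinate v of alpha_j at time aread t j v, completes
   its reads at time read_end t, and writes coordinate v of x (resp. of
   alpha_{i_t}) at time xwrite t v (resp. awrite t v). The two write times are
   relevant only for v in the support of the gradient of f_{i_t}. *)
Record schedule (R : realType) (d n : nat) : Type := Schedule {
  start : nat -> R ;
  xread : nat -> 'I_d -> R ;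
  aread : nat -> 'I_n -> 'I_d -> R ;
  read_end : nat -> R ;
  xwrite : nat -> 'I_d -> R ;
  awrite : nat -> 'I_d -> R ;
  finish : nat -> R }.

(* Iterations are labelled in the order of completion of their reads
   (order_read_end). *)
Record valid_schedule (R : realType) (d n : nat) (f : 'I_n -> 'rV[R]_d -> R)
    (idx : nat -> 'I_n) (s : schedule R d n) : Prop := ValidSchedule {
  time_xread : forall t v, start s t <= xread s t v <= read_end s t ;
  time_aread : forall t j v, start s t <= aread s t j v <= read_end s t ;
  time_phases : forall t, start s t <= read_end s t <= finish s t ;
  time_xwrite : forall t v, v \in supp f (idx t) ->
    read_end s t <= xwrite s t v <= finish s t ;
  time_awrite : forall t v, v \in supp f (idx t) ->
    read_end s t <= awrite s t v <= finish s t ;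
  order_read_end : forall t u, (t <= u)%N -> read_end s t <= read_end s u }.

Definition bounded_overlap (R : realType) (d n : nat) (tau : nat)
    (s : schedule R d n) : Prop :=
  forall t r, (t + tau + 1 <= r)%N ->
    [set` `[start s t, finish s t]] `&` [set` `[start s r, finish s r]] = set0.

(* A write is visible to the reads that take place strictly after it. In a
   valid schedule a write visible to iteration t belongs to some u < t, since
   read_end u <= xwrite u v < xread t v <= read_end t; this is why the
   conditions u < t below exclude nothing. *)
Definition xvisible (R : realType) (d n : nat) (f : 'I_n -> 'rV[R]_d -> R)
    (idx : nat -> 'I_n) (s : schedule R d n) (t : nat) (v : 'I_d) (u : nat) :
    bool :=
  (v \in supp f (idx u)) && (xwrite s u v < xread s t v).

Definition avisible (R : realType) (d n : nat) (f : 'I_n -> 'rV[R]_d -> R)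
    (idx : nat -> 'I_n) (s : schedule R d n) (t : nat) (j : 'I_n) (v : 'I_d)
    (u : nat) : bool :=
  [&& (u < t)%N, idx u == j, v \in supp f j & awrite s u v < aread s t j v].

(* xh, ah and idx are the values read and the indices sampled by the successive
   iterations of a run of the algorithm scheduled by s. As the updates of x are
   atomic, the value of a coordinate of x in memory is its initial value plus
   all the updates made so far, whatever their order. *)
Record asaga_run (R : realType) (d n : nat) (f : 'I_n -> 'rV[R]_d -> R)
    (gamma : R) (x0 : 'rV[R]_d) (alpha0 : 'I_n -> 'rV[R]_d) (tau : nat)
    (xh : nat -> 'rV[R]_d) (ah : nat -> 'I_n -> 'rV[R]_d) (idx : nat -> 'I_n)
    (s : schedule R d n) : Prop := AsagaRun {
  run_valid : valid_schedule f idx s ;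
  run_overlap : bounded_overlap tau s ;
  run_x : forall t v,
    xh t 0 v = x0 0 v -
      \sum_(u < t | xvisible f idx s t v u)
        gamma * asaga_dir f (xh u) (ah u) (idx u) 0 v ;
  run_alpha : forall t j v,
    ((forall u, ~~ avisible f idx s t j v u) /\ ah t j 0 v = alpha0 j 0 v) \/
    (exists u, [/\ avisible f idx s t j v u,
      forall w, avisible f idx s t j v w -> awrite s w v <= awrite s u v &
      ah t j 0 v = grad (f j) (xh u) 0 v]) }.

(* The sigma-algebra generated by the reads of the iterations u <= t and by the
   indices sampled by the iterations u < t. *)
Definition past (R : realType) (d n : nat) (disp : measure_display)
    (T : measurableType disp) (xhat : nat -> T -> 'rV[R]_d)
    (ahat : nat -> T -> 'I_n -> 'rV[R]_d) (idx : nat -> T -> 'I_n) (t : nat) :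
    set (set T) :=
  <<s [set A | exists u v (B : set R), [/\ (u <= t)%N, measurable B &
               A = (fun w => xhat u w 0 v) @^-1` B]] `|`
      [set A | exists u j v (B : set R), [/\ (u <= t)%N, measurable B &
               A = (fun w => ahat u w j 0 v) @^-1` B]] `|`
      [set A | exists u i, (u < t)%N /\ A = [set w | idx u w = i]] >>.

Record asaga_process (R : realType) (d n : nat) (f : 'I_n -> 'rV[R]_d -> R)
    (gamma : R) (x0 : 'rV[R]_d) (alpha0 : 'I_n -> 'rV[R]_d) (tau : nat)
    (disp : measure_display) (T : measurableType disp) (P : probability T R)
    (xhat : nat -> T -> 'rV[R]_d) (ahat : nat -> T -> 'I_n -> 'rV[R]_d)
    (idx : nat -> T -> 'I_n) : Prop := AsagaProcess {
  process_run : forall w, exists s : schedule R d n,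
    asaga_run f gamma x0 alpha0 tau
      (fun t => xhat t w) (fun t => ahat t w) (fun t => idx t w) s ;
  measurable_xhat : forall t v,
    measurable_fun [set: T] (fun w => xhat t w 0 v) ;
  measurable_ahat : forall t j v,
    measurable_fun [set: T] (fun w => ahat t w j 0 v) ;
  measurable_idx : forall t i, measurable [set w | idx t w = i] ;
  uniform_idx : forall t i, P [set w | idx t w = i] = (n%:R^-1)%:E ;
  independent_idx : forall t i A, past xhat ahat idx t A ->
    P (A `&` [set w | idx t w = i]) = (P A * P [set w | idx t w = i])%E }.

Definition xi (R : realType) (kappa Delta : R) (tau : nat) : R :=
  Num.sqrt (1 + (8 * kappa)^-1 * Num.min (Num.sqrt Delta)^-1 tau%:R).

Definition astar (R : realType) (kappa Delta : R) (tau : nat) : R :=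
  (32 * (1 + tau%:R * Num.sqrt Delta) * xi kappa Delta tau)^-1.

Definition rho (R : realType) (n : nat) (kappa a : R) : R :=
  5^-1 * Num.min n%:R^-1 (a / kappa).

Definition C0 (R : realType) (d n : nat) (f : 'I_n -> 'rV[R]_d -> R) (L : R)
    (xs x0 : 'rV[R]_d) (alpha0 : 'I_n -> 'rV[R]_d) : R :=
  enorm (x0 - xs) ^+ 2 +
  (5 * L ^+ 2)^-1 * \sum_i enorm (alpha0 i - grad (f i) xs) ^+ 2.

(* Main.v *)
Require Import Defs.
From HB Require Import structures.
From mathcomp Require Import all_boot all_order all_algebra.
From mathcomp Require Import all_classical all_reals all_analysis.
From mathcomp Require Import ring lra zify.

(* With x_(t+1) = x_t - gamma g_t, expand |x_(t+1) - xs|^2. Conditionally on the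
   past of read t, g_t is an unbiased estimate of the gradient at xhat_t, so
   strong convexity gives the decrease 2 gamma e_t, e_t = E f(xhat_t) - f(xs).
   The error xhat_t - x_t is a sum of at most tau delayed updates, and since i_t
   is independent of g_u for u < t, sparsity makes the expected overlap of g_u
   and g_t of order sqrt Delta. The second moments of the g_t are in turn
   bounded by e_t plus a geometrically weighted sum of the past e_u, because a
   memory cell survives k fresh samplings with probability (1 - 1/n)^k.
   Multiplying the recursion by (1 - rho)^-(t+1) and summing over t makes
   |x_t - xs|^2 telescope, and the total weight of e_u on the right stays below
   gamma (1 - rho)^-(u+1), which is absorbed on the left.

   For fixed t everything takes finitely many values, so all random variables
   below are finite combinations of indicators of past events. *)

Set Implicit Arguments.
Unset Strict Implicit.
Unset Printing Implicit Defensive.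

Import Order.TTheory GRing.Theory Num.Theory.
Import numFieldNormedType.Exports.

Local Open Scope classical_set_scope.
Local Open Scope ring_scope.

(** * Smooth and strongly convex functions *)

Section dot.
Context {R : realType} {d : nat}.
Implicit Types (x y z : 'rV[R]_d) (c : R).

(** A schedule exists separately for each outcome, with no measurability in the outcome, and the set
    of writes missed by a read may be correlated with the samples. Schedules therefore enter only
    through inequalities valid on every single run: coordinatewise absolute values for the delay,
    sums of nonnegative terms for the memory. The right-hand sides involve reads and indices alone,
    and expectations are taken only afterwards. Conditioning on the past is replaced by integrating
    finitely valued past variables against the indicator of a sampled index.

    The constants rest on two margins. Since [rho] is at most [1 / (5 n)], a gap of at least
    [4 / (5 n)] separates [1 - rho] from [1 - 1/n]: the weighted memory kernel keeps a total mass of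
    order [n], which the sampling probability [1/n] compensates. Since [tau < n / 10], the weights
    accumulated over one or two overlap windows stay close to 1. *)

Definition dot x y : R := \sum_v x 0 v * y 0 v.

Lemma dotC x y : dot x y = dot y x.
Proof. by apply: eq_bigr => v _; rewrite mulrC. Qed.

Lemma dotDl x y z : dot (x + y) z = dot x z + dot y z.
Proof. by rewrite -big_split; apply: eq_bigr => v _; rewrite mxE mulrDl. Qed.

Lemma dotZl c x z : dot (c *: x) z = c * dot x z.
Proof. by rewrite mulr_sumr; apply: eq_bigr => v _; rewrite mxE mulrA. Qed.

Lemma dotNl x z : dot (- x) z = - dot x z.
Proof. by rewrite -scaleN1r dotZl mulN1r. Qed.

Lemma dotBl x y z : dot (x - y) z = dot x z - dot y z.
Proof. by rewrite dotDl dotNl. Qed.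

Lemma dotDr x y z : dot z (x + y) = dot z x + dot z y.
Proof. by rewrite dotC dotDl !(dotC z). Qed.

Lemma dotZr c x z : dot z (c *: x) = c * dot z x.
Proof. by rewrite dotC dotZl dotC. Qed.

Lemma dotNr x z : dot z (- x) = - dot z x.
Proof. by rewrite dotC dotNl dotC. Qed.

Lemma dotBr x y z : dot z (x - y) = dot z x - dot z y.
Proof. by rewrite dotDr dotNr. Qed.

Definition dotE := (dotDl, dotDr, dotBl, dotBr, dotNl, dotNr, dotZl, dotZr).

Lemma dot_suml (I : Type) (r : seq I) (P : pred I) (F : I -> 'rV[R]_d) z :
  dot (\sum_(i <- r | P i) F i) z = \sum_(i <- r | P i) dot (F i) z.
Proof.
elim/big_rec2: _ => [|i a b _ <-]; last by rewrite dotDl.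
by rewrite /dot big1// => v _; rewrite mxE mul0r.
Qed.

Lemma dot_ge0 x : 0 <= dot x x.
Proof. by apply: sumr_ge0 => v _; rewrite -expr2 sqr_ge0. Qed.

Lemma dot_eq0 x : dot x x <= 0 -> x = 0.
Proof.
move=> x0; have /eqP : dot x x = 0 by apply/eqP; rewrite eq_le x0 dot_ge0.
rewrite psumr_eq0 => [/allP h|v _]; last by rewrite -expr2 sqr_ge0.
apply/rowP => v; have := h v (mem_index_enum _).
by rewrite /= mulf_eq0 orbb mxE => /eqP.
Qed.

Lemma dot_const1_gt0 : (0 < d)%N -> 0 < dot (const_mx 1) (const_mx 1).
Proof.
move=> d0; rewrite /dot (eq_bigr (fun=> 1)) => [|v _]; last by rewrite !mxE mulr1.
by rewrite sumr_const card_ord ltr0n.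
Qed.

Lemma enorm_sqr x : enorm x ^+ 2 = dot x x.
Proof.
rewrite /enorm sqr_sqrtr; first by apply: eq_bigr => v _; rewrite expr2.
by apply: sumr_ge0 => v _; rewrite sqr_ge0.
Qed.

Lemma young_dot c x y : 0 < c -> 2 * dot x y <= c * dot x x + c^-1 * dot y y.
Proof.
move=> c0; rewrite /dot !mulr_sumr -big_split/=; apply: ler_sum => v _.
have : 0 <= c^-1 * (c * x 0 v - y 0 v) ^+ 2.
  by rewrite mulr_ge0 ?sqr_ge0 ?invr_ge0 ?ltW.
have -> : c^-1 * (c * x 0 v - y 0 v) ^+ 2 = c * (x 0 v * x 0 v)
   + c^-1 * (y 0 v * y 0 v) - 2 * (x 0 v * y 0 v) by field; rewrite gt_eqF.
by rewrite subr_ge0.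
Qed.

End dot.

Section smooth.
Context {R : realType} {d : nat}.
Implicit Types (h : 'rV[R]_d -> R) (x y v : 'rV[R]_d).

Lemma derive_dot h x v : differentiable h x -> 'D_v h x = dot (grad h x) v.
Proof.
move=> hx; rewrite deriveE// [in LHS](row_sum_delta v) linear_sum/=.
by apply: eq_bigr => k _; rewrite linearZ/= mxE deriveE// mulrC.
Qed.

Lemma is_derive_line h x v (t : R) : (forall y, differentiable h y) ->
  is_derive t 1 (fun t : R => h (x + t *: v)) (dot (grad h (x + t *: v)) v).
Proof.
move=> hd; have E : (fun e : R => e^-1 *: (h (x + (e *: (1 : R) + t) *: v)
    - h (x + t *: v))) =
  (fun e : R => e^-1 *: (h (e *: v + (x + t *: v)) - h (x + t *: v))).
  apply/funext => e; congr (_ *: (h _ - _)).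
  by rewrite -[e *: 1]/(e * 1) mulr1 scalerDl addrCA.
have dh : derivable h (x + t *: v) v by exact: diff_derivable.
apply: DeriveDef; first by rewrite /derivable /= E.
by rewrite -derive_dot// /derive /= E.
Qed.

(** Strong convexity at [e *: y + (1 - e) *: x], divided by [e], gives this in the limit as [e]
    decreases to 0. It serves with [m = mu] for [fmean f] and with [m = 0] for each [f i]. *)
Lemma strongly_convex_tangent (m : R) h x y : strongly_convex m h ->
  (forall z, differentiable h z) ->
  h x + dot (grad h x) (y - x) + m / 2 * dot (y - x) (y - x) <= h y.
Proof.
move=> sc hd; set N := dot (y - x) (y - x).
have dh : derivable h x (y - x) by exact: diff_derivable.
have cv : (fun e : R => e^-1 *: (h (e *: (y - x) + x) - h x)) e @[e --> 0^'+] -->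
    dot (grad h x) (y - x).
  by rewrite -derive_dot//; apply: cvg_dnbhs_at_right; exact: dh.
have cv2 : (h y - h x - m / 2 * (1 - e) * N) @[e --> (0 : R)^'+] -->
    h y - h x - m / 2 * (1 - 0) * N.
  apply: cvg_at_right_filter; apply: cvgB; first exact: cvg_cst.
  apply: cvgMl; apply: cvgMr; apply: cvgB; first exact: cvg_cst.
  exact: cvg_id.
have : dot (grad h x) (y - x) <= h y - h x - m / 2 * (1 - 0) * N.
  apply: (ler_cvg_to cv cv2); near=> e.
  have e0 : 0 < e by near: e; exact: nbhs_right_gt.
  have e1 : e <= 1 by near: e; exact: nbhs_right_le.
  have := sc e y x; rewrite e1 (ltW e0) => /(_ isT).
  rewrite enorm_sqr -/N.
  have -> : e *: y + (1 - e) *: x = e *: (y - x) + x.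
    by rewrite scalerBr scalerBl scale1r addrA addrAC.
  move=> H; rewrite -[X in X <= _]/(e^-1 * (h (e *: (y - x) + x) - h x)).
  rewrite ler_pdivrMl//; lra.
lra.
Unshelve. all: by end_near.
Qed.

Lemma lipschitz_grad_sqr (L : R) h x y : lipschitz_grad L h ->
  dot (grad h x - grad h y) (grad h x - grad h y) <=
  L ^+ 2 * dot (x - y) (x - y).
Proof.
move=> lip; rewrite -!enorm_sqr -exprMn ler_pXn2r//.
- by rewrite nnegrE sqrtr_ge0.
- by rewrite nnegrE (le_trans _ (lip x y))// sqrtr_ge0.
Qed.

(** [psi] is [h] along the segment minus the quadratic model. The mean value theorem gives an
    increment of [psi] equal to [dpsi c] with [0 < c < 1], and [dpsi c] is nonpositive by the
    Lipschitz bound. *)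
Lemma descent_lemma (L : R) h x y : 0 < L -> lipschitz_grad L h ->
  (forall z, differentiable h z) ->
  h y <= h x + dot (grad h x) (y - x) + L / 2 * dot (y - x) (y - x).
Proof.
move=> L0 lip hd; set v := y - x; set N := dot v v; set D := dot _ v.
pose phi (t : R) : R := h (x + t *: v).
pose psi (t : R) : R := phi t - (D * t + L / 2 * N * t ^+ 2).
pose dpsi (t : R) : R := dot (grad h (x + t *: v)) v - (D + L * N * t).
have dpsiP (t : R) : is_derive t 1 psi (dpsi t).
  have P1 := is_derive_line x v t hd.
  apply: is_derive_eq; rewrite /dpsi; congr (_ - _).
  rewrite -!scalerA /GRing.scale/= !mulr1; lra.
have [|c] := @MVT R psi dpsi 0 1 ltr01 (fun t _ => dpsiP t).
  apply: derivable_within_continuous => t _.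
  by have [] := dpsiP t.
rewrite in_itv/= => /andP[c0 c1].
rewrite subr0 mulr1 /psi /phi scale1r scale0r addr0 expr0n/= expr1n !mulr0 !mulr1.
have -> : x + v = y by rewrite /v addrC subrK.
suff : dpsi c <= 0 by rewrite -/D; lra.
rewrite /dpsi /D.
have /= := lipschitz_grad_sqr (x + c *: v) x lip.
have -> : x + c *: v - x = c *: v by rewrite addrAC subrr add0r.
(* Young's inequality with this weight balances both terms at [c * L * N] and takes the place of
   Cauchy-Schwarz. *)
have cL : 0 < (c * L)^-1 by rewrite invr_gt0 mulr_gt0.
have := young_dot (grad h (x + c *: v) - grad h x) v cL.
rewrite invrK; set u := grad h _ - _; rewrite [dot (c *: v) _]dotZl dotZr -/N.
set q := dot u u => H1 H2.
have : (c * L)^-1 * q <= c * L * N.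
  by rewrite ler_pdivrMl ?mulr_gt0//; lra.
have := dotBl (grad h (x + c *: v)) (grad h x) v; rewrite -/u; lra.
Qed.

(** Let [z] be the step from [x] along minus the gradient difference, of length factor [L^-1]. The
    value [h z] is bounded above by the descent lemma at [x] and below by the tangent at [y];
    comparing the two gives the claim. *)
Lemma cocoercivity (L : R) h x y : 0 < L -> lipschitz_grad L h ->
  strongly_convex 0 h -> (forall z, differentiable h z) ->
  dot (grad h x - grad h y) (grad h x - grad h y) <=
  2 * L * (h x - h y - dot (grad h y) (x - y)).
Proof.
move=> L0 lip cvx hd; set g := grad h x - grad h y.
have gE : g = grad h x - grad h y by [].
clearbody g; pose z := x - L^-1 *: g.
have H1 := strongly_convex_tangent y z cvx hd.
have H2 := descent_lemma x z L0 lip hd.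
have zx : z - x = - (L^-1 *: g) by rewrite /z addrAC subrr add0r.
have zy : z - y = (x - y) - L^-1 *: g by rewrite /z addrAC.
have LL : L / 2 * dot (- (L^-1 *: g)) (- (L^-1 *: g)) = L^-1 * dot g g / 2.
  by rewrite !dotE; field; rewrite gt_eqF.
move: H1 H2; rewrite mul0r zx zy LL !dotE; set xx := dot (grad h x) g.
set yy := dot (grad h y) g; set k := h x; set l := h y; set m := h z.
have -> : dot g g = xx - yy by rewrite {1}gE dotBl.
rewrite !mul0r addr0 => H1 H2.
have H3 : L^-1 * (xx - yy) <= 2 * (k - l - (dot (grad h y) x - dot (grad h y) y)).
  lra.
by move: H3; rewrite ler_pdivrMl//; lra.
Qed.

End smooth.

Section mean.
Context {R : realType} {d n : nat} (f : 'I_n -> 'rV[R]_d -> R).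
Hypothesis f_diff : forall i x, differentiable (f i) x.

Lemma convex_strongly0 (h : 'rV[R]_d -> R) :
  convex_function [set: 'rV[R]_d] h -> strongly_convex 0 h.
Proof.
move=> ch l x y l01.
case/andP: (l01) => l0 l1.
have /= := ch (Itv01 l0 l1) x y (mem_setT _) (mem_setT _).
rewrite mul0r !mul0r subr0; exact.
Qed.

Lemma differentiable_fmean x : differentiable (fmean f) x.
Proof.
have -> : fmean f = n%:R^-1 *: \sum_i f i.
  by apply/funext => y; rewrite /fmean /= fct_sumE.
by apply: differentiableZ; exact: differentiable_sum.
Qed.

Lemma grad_fmean x : grad (fmean f) x = n%:R^-1 *: \sum_i grad (f i) x.
Proof.
have -> : fmean f = n%:R^-1 *: \sum_i f i.
  by apply/funext => y; rewrite /fmean /= fct_sumE.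
apply/rowP => v; rewrite !mxE deriveZ; last first.
  by apply: derivable_sum => i; exact: diff_derivable.
rewrite derive_sum; last by move=> i; exact: diff_derivable.
by rewrite summxE; congr (_ *: _); apply: eq_bigr => i _; rewrite mxE.
Qed.

End mean.

(** * Consequences of strong convexity and minimality *)

Section objective.
Context {R : realType} {d n : nat} (f : 'I_n -> 'rV[R]_d -> R) (L mu : R).
Context (xs : 'rV[R]_d).
Hypothesis d_gt0 : (0 < d)%N.
Hypothesis n_gt0 : (0 < n)%N.
Hypothesis f_convex : forall i, convex_function [set: 'rV[R]_d] (f i).
Hypothesis f_diff : forall i x, differentiable (f i) x.
Hypothesis f_lip : forall i, lipschitz_grad L (f i).
Hypothesis mu_gt0 : 0 < mu.
Hypothesis f_strong : strongly_convex mu (fmean f).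
Hypothesis xs_min : forall x, fmean f xs <= fmean f x.

Lemma fmean_tangent x y : fmean f x + dot (grad (fmean f) x) (y - x) +
  mu / 2 * dot (y - x) (y - x) <= fmean f y.
Proof.
exact: strongly_convex_tangent f_strong (differentiable_fmean f_diff).
Qed.

(** Constant gradients would make the gradient of [fmean f] constant, and adding the two tangent
    inequalities between two distinct points contradicts [mu > 0]. The positivity of [L] and of
    [Delta f] is deduced from this. *)
Lemma grad_nonconstant : ~ (forall i x y, grad (f i) x = grad (f i) y).
Proof.
move=> gcst; pose x : 'rV[R]_d := 0; pose y : 'rV[R]_d := const_mx 1.
have gE : grad (fmean f) x = grad (fmean f) y.
  by rewrite !grad_fmean//; congr (_ *: _); apply: eq_bigr => i _; exact: gcst.
have := fmean_tangent x y; have := fmean_tangent y x.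
have := @dot_const1_gt0 R _ d_gt0.
rewrite gE /x sub0r subr0 -/y !dotE opprK => N0 H1 H2.
have : 0 < mu * dot y y by rewrite mulr_gt0.
lra.
Qed.

Lemma lipschitz_const_gt0 : 0 < L.
Proof.
rewrite ltNge; apply/negP => L0; apply: grad_nonconstant => i x y.
have := f_lip i x y => h; apply/eqP; rewrite -subr_eq0; apply/eqP/dot_eq0.
rewrite -enorm_sqr; have -> : enorm (grad (f i) x - grad (f i) y) = 0.
  apply/eqP; rewrite eq_le sqrtr_ge0 andbT (le_trans h)//.
  by rewrite mulr_le0_ge0// sqrtr_ge0.
by rewrite expr0n.
Qed.

Lemma grad_notin_supp i x v : v \notin supp f i -> grad (f i) x 0 v = 0.
Proof.
move=> vS; apply: contrapT => gx; move/negP: vS; apply.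
by rewrite inE; apply/asboolP; exists x; apply/eqP.
Qed.

Lemma Delta_gt0 : 0 < Delta f.
Proof.
apply: mulr_gt0; first by rewrite invr_gt0 ltr0n.
rewrite ltr0n.
rewrite lt0n; apply/negP => /eqP max0; apply: grad_nonconstant => i x y.
suff S0 v : v \notin supp f i by apply/rowP => v; rewrite !grad_notin_supp.
have : (occ f v <= \max_v occ f v)%N by exact: leq_bigmax.
rewrite max0 leqn0 cards_eq0 => /eqP o0; apply/negP => vS.
have : i \in [set i | v \in supp f i]%SET by rewrite inE.
by rewrite o0 inE.
Qed.

Lemma pv_le_Delta v : pv f v <= Delta f.
Proof. by rewrite ler_pM2l ?invr_gt0 ?ltr0n// ler_nat; exact: leq_bigmax. Qed.

Lemma pvE v : pv f v = n%:R^-1 * \sum_i (v \in supp f i)%:R.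
Proof.
congr (_ * _); rewrite /occ -sum1_card natr_sum big_mkcond/=.
by apply: eq_bigr => i _; rewrite inE; case: ifP.
Qed.

(** Averaging the descent lemma over [i] at a gradient step of length [L^-1] from [xs] would lower
    [fmean f] below its minimum unless the mean gradient vanishes. *)
Lemma sum_grad_min : \sum_i grad (f i) xs = 0.
Proof.
have L0 := lipschitz_const_gt0; have n0 : 0 < n%:R^-1 :> R by rewrite invr_gt0 ltr0n.
set s := \sum_i _; pose y := xs - L^-1 *: (n%:R^-1 *: s).
have H i : f i y <= f i xs + dot (grad (f i) xs) (y - xs) + L / 2 * dot (y - xs) (y - xs).
  exact: descent_lemma.
have yE : y - xs = - (L^-1 *: (n%:R^-1 *: s)) by rewrite /y addrAC subrr add0r.
have : fmean f y <= fmean f xs + n%:R^-1 * dot s (y - xs) + L / 2 * dot (y - xs) (y - xs).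
  rewrite /s dot_suml /fmean -mulrDr -big_split/=.
  set c := L / 2 * _; rewrite (_ : c = n%:R^-1 * \sum_(i < n) c); last first.
    by rewrite sumr_const card_ord -[c *+ n]mulr_natl mulrA mulVf ?mul1r// pnatr_eq0 -lt0n.
  by rewrite -mulrDr -big_split/= ler_pM2l//; apply: ler_sum => i _; exact: H.
have sE : dot s (y - xs) = - (L^-1 * (n%:R^-1 * dot s s)) by rewrite yE !dotE.
have yyE : L / 2 * dot (y - xs) (y - xs) =
    2^-1 * (n%:R^-1 * (L^-1 * (n%:R^-1 * dot s s))).
  by rewrite yE !dotE; field; rewrite !gt_eqF// ltr0n.
rewrite sE yyE mulrN => H1; have := xs_min y; set q := n%:R^-1 * (L^-1 * _) in H1 *.
move=> H2; apply: dot_eq0; have q0 : q <= 0 by lra.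
by move: q0; rewrite /q pmulr_rle0// pmulr_rle0 ?invr_gt0// pmulr_rle0.
Qed.

(** The linear terms of the individual cocoercivity bounds cancel in the mean, because the gradients
    at [xs] sum to zero. *)
Lemma mean_cocoercivity x :
  n%:R^-1 * \sum_i dot (grad (f i) x - grad (f i) xs) (grad (f i) x - grad (f i) xs)
  <= 2 * L * (fmean f x - fmean f xs).
Proof.
have n0 : 0 < n%:R^-1 :> R by rewrite invr_gt0 ltr0n.
rewrite /fmean -mulrBr mulrCA ler_pM2l// -sumrB.
have Z : \sum_i dot (grad (f i) xs) (x - xs) = 0.
  by rewrite -dot_suml sum_grad_min /dot big1// => v _; rewrite mxE mul0r.
rewrite -[in leRHS](subr0 (\sum_i _)) -[in X in _ - X]Z.
rewrite -sumrB mulr_sumr; apply: ler_sum => i _.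
apply: cocoercivity => //; first exact: lipschitz_const_gt0.
exact: convex_strongly0.
Qed.

Lemma mean_grad_inner x :
  fmean f x - fmean f xs + mu / 2 * dot (x - xs) (x - xs) <=
  dot (n%:R^-1 *: \sum_i grad (f i) x) (x - xs).
Proof.
have := fmean_tangent x xs; rewrite grad_fmean// -(opprB x xs) dotNr dotNl dotNr.
rewrite opprK; lra.
Qed.

End objective.

(** * Asynchronous runs *)

Section direction.
Context {R : realType} {d n : nat} (f : 'I_n -> 'rV[R]_d -> R).
Implicit Types (x xs : 'rV[R]_d) (a : 'I_n -> 'rV[R]_d).

Lemma asaga_dirE x a i v : asaga_dir f x a i 0 v =
  grad (f i) x 0 v - a i 0 v +
  (n%:R^-1 * \sum_k a k 0 v) * ((v \in supp f i)%:R * (pv f v)^-1).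
Proof.
rewrite /asaga_dir /Dimx /projmx /Dmx mulmx_diag mul_mx_diag !mxE.
by rewrite summxE.
Qed.

Lemma asaga_dir_notin_supp x a i v : a i 0 v = 0 -> v \notin supp f i ->
  asaga_dir f x a i 0 v = 0.
Proof.
move=> a0 vS; rewrite asaga_dirE (negbTE vS) a0 grad_notin_supp//.
by rewrite mul0r mulr0 subrr addr0.
Qed.

Hypothesis n_gt0 : (0 < n)%N.

Let sum_supp v : \sum_i (v \in supp f i)%:R = n%:R * pv f v :> R.
Proof. by rewrite pvE mulrA divff ?mul1r// pnatr_eq0 -lt0n. Qed.

Let pv_eq0 v : pv f v = 0 -> forall i, v \notin supp f i.
Proof.
move=> p0 i; have := sum_supp v; rewrite p0 mulr0 => /eqP.
rewrite psumr_eq0 => [/allP/(_ i (mem_index_enum _))|j _]; last exact: ler0n.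
by rewrite pnatr_eq0 /= eqb0.
Qed.

(** Unbiasedness: coordinate [v] of the correction is scaled by [1 / p_v] and received by exactly
    [n * p_v] indices, so in total it restores the subtracted memory. *)
Lemma sum_asaga_dir x a : (forall i v, v \notin supp f i -> a i 0 v = 0) ->
  \sum_i asaga_dir f x a i = \sum_i grad (f i) x.
Proof.
move=> a0; apply/rowP => v; rewrite !summxE.
under eq_bigr do rewrite asaga_dirE.
rewrite big_split/= sumrB -mulr_sumr -mulr_suml sum_supp.
(* For [p_v = 0] the inverse is 0 by convention; [v] then lies in no support and all memory entries
   at [v] vanish. *)
have [p0|p0] := eqVneq (pv f v) 0.
  rewrite [\sum_i a i 0 v]big1; last by move=> i _; apply/a0/pv_eq0.
  by rewrite mulr0 mul0r subr0 addr0.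
have nR : n%:R != 0 :> R by rewrite pnatr_eq0 -lt0n.
rewrite mulfK// [n%:R^-1 * _]mulrC mulfVK//.
by rewrite subrK.
Qed.

(* The D_i-weighted average is the best correction of the memory terms
   supported on the S_i, so subtracting it can only reduce the second moment. *)
Lemma sum_asaga_dir_sqr x xs a : (forall i v, v \notin supp f i -> a i 0 v = 0) ->
  \sum_i grad (f i) xs = 0 ->
  \sum_i dot (asaga_dir f x a i) (asaga_dir f x a i) <=
  2 * \sum_i dot (grad (f i) x - grad (f i) xs) (grad (f i) x - grad (f i) xs)
  + 2 * \sum_i dot (a i - grad (f i) xs) (a i - grad (f i) xs).
Proof.
move=> a0 gs0; rewrite -mulrDr -big_split/= mulr_sumr.
rewrite [leRHS](eq_bigr (fun i => \sum_v 2 * ((grad (f i) x 0 v - grad (f i) xs 0 v) ^+ 2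
   + (a i 0 v - grad (f i) xs 0 v) ^+ 2))); last first.
  move=> i _; rewrite -mulr_sumr -big_split/=; congr (2 * _).
  by apply: eq_bigr => v _; rewrite !mxE !expr2.
rewrite exchange_big/= [leRHS]exchange_big/=; apply: ler_sum => v _.
pose b i := a i 0 v - grad (f i) xs 0 v.
pose m := n%:R^-1 * \sum_k a k 0 v; pose c := m * (pv f v)^-1.
have gv0 : \sum_i grad (f i) xs 0 v = 0 by rewrite -summxE gs0 mxE.
have nR : n%:R != 0 :> R by rewrite pnatr_eq0 -lt0n.
have sb : \sum_i b i = n%:R * m.
  by rewrite sumrB gv0 subr0 /m mulrA divff// mul1r.
have bS i : b i * (v \in supp f i)%:R = b i.
  have [|vS] := boolP (v \in _); first by rewrite mulr1.
  by rewrite /b a0// grad_notin_supp// subrr mul0r.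
(* Expanding the square with [c = m / p_v] and [\sum_i b i = n m], the two sides differ by
   [n m ^ 2 / p_v]. *)
have var : \sum_i (b i - c * (v \in supp f i)%:R) ^+ 2 <= \sum_i b i ^+ 2.
  have -> : \sum_i (b i - c * (v \in supp f i)%:R) ^+ 2 =
      \sum_i b i ^+ 2 - 2 * c * (n%:R * m) + c ^+ 2 * (n%:R * pv f v).
    rewrite -sb -sum_supp !mulr_sumr -sumrB -big_split/=; apply: eq_bigr => i _.
    have := bS i; case: (v \in _) => /= bi; first by ring.
    by rewrite -bi; ring.
  have [p0|p0] := eqVneq (pv f v) 0.
    by rewrite /c p0 invr0 !mulr0 mul0r subr0 addr0.
  have -> : c ^+ 2 * (n%:R * pv f v) = n%:R * (m ^+ 2 / pv f v) by rewrite /c; field.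
  have -> : 2 * c * (n%:R * m) = 2 * (n%:R * (m ^+ 2 / pv f v)) by rewrite /c; field.
  have : 0 <= n%:R * (m ^+ 2 / pv f v).
    by rewrite mulr_ge0// divr_ge0 ?sqr_ge0// /pv mulr_ge0 ?invr_ge0.
  lra.
apply: (@le_trans _ _ (\sum_i (2 * (grad (f i) x 0 v - grad (f i) xs 0 v) ^+ 2
   + 2 * (b i - c * (v \in supp f i)%:R) ^+ 2))).
  apply: ler_sum => i _; rewrite asaga_dirE -/m.
  set g := grad (f i) x 0 v; set h := (v \in supp f i)%:R.
  have -> : m * (h / pv f v) = c * h by rewrite /c; ring.
  rewrite /b; set k := grad (f i) xs 0 v; set l := a i 0 v; set z := c * h.
  (* The direction is the difference of [g - k] and [l - k - z], so its square is at most twice the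
     sum of their squares. *)
  have := sqr_ge0 ((g - k) + (l - k - z)); rewrite !expr2; lra.
rewrite big_split/= -!mulr_sumr.
by rewrite [in leRHS]big_split/=; move: var; rewrite /b; lra.
Qed.

End direction.

(** The interval ends just before [t - tau]. By truncated subtraction it is empty when
    [t <= u + 2 * tau + 1]. *)
Lemma window_bounds (u m t tau : nat) :
  (u + tau + 1 <= m < u + tau + 1 + (t - 2 * tau - u - 1))%N ->
  [/\ (u + tau + 1 <= m)%N, (m + tau + 1 <= t)%N & (m < t)%N].
Proof. by move=> h; split; lia. Qed.

(** * A single run under bounded overlap *)

Section schedule.
Context {R : realType} {d n : nat} (f : 'I_n -> 'rV[R]_d -> R) (gamma : R).
Context (x0 : 'rV[R]_d) (alpha0 : 'I_n -> 'rV[R]_d) (tau : nat).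
Context (xh : nat -> 'rV[R]_d) (ah : nat -> 'I_n -> 'rV[R]_d).
Context (idx : nat -> 'I_n) (s : schedule R d n).
Hypothesis gamma_ge0 : 0 <= gamma.
Hypothesis alpha0_supp : forall i v, v \notin supp f i -> alpha0 i 0 v = 0.
Hypothesis run : asaga_run f gamma x0 alpha0 tau xh ah idx s.

Let g u := asaga_dir f (xh u) (ah u) (idx u).

(** Disjointness alone would allow [r] to be processed before [t]; the order of read completions
    excludes this, since otherwise the later of the two starts would lie in both intervals. *)
Lemma finish_before_start t r : (t + tau + 1 <= r)%N -> finish s t < start s r.
Proof.
move=> tr; have V := run_valid run; rewrite ltNge; apply/negP => rt.
have /andP[sr1 rf1] := time_phases V t; have /andP[sr2 rf2] := time_phases V r.
have re : read_end s t <= read_end s r by apply: (order_read_end V); lia.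
have : (set0 : set R) (Num.max (start s t) (start s r)).
  rewrite -(run_overlap run tr); split; rewrite /= in_itv/= le_max lexx ?orbT//=.
    by rewrite ge_max rt (le_trans sr1).
  by rewrite ge_max (le_trans sr2)// (le_trans sr1)// (le_trans re).
by [].
Qed.

Lemma memory_notin_supp t j v : v \notin supp f j -> ah t j 0 v = 0.
Proof.
move=> vS; have [[_ ->]|[u [_ _ ->]]] := run_alpha run t j v.
  exact: alpha0_supp.
exact: grad_notin_supp.
Qed.

Lemma dir_notin_supp u v : v \notin supp f (idx u) -> g u 0 v = 0.
Proof. by move=> vS; apply: asaga_dir_notin_supp => //; exact: memory_notin_supp. Qed.

(** Visible updates cancel against the virtual iterate. An update older than [tau] iterations is
    finished before [t] starts, so it is either visible or zero at [v]. Absolute values make the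
    bound independent of which recent updates are missing. *)
Lemma read_delay t v :
  `|xh t 0 v - (x0 - gamma *: \sum_(u < t) g u) 0 v| <=
  gamma * \sum_(u < t | (t <= u + tau)%N) `|g u 0 v|.
Proof.
rewrite (run_x run) !mxE summxE -mulr_sumr.
rewrite [\sum_(i < t) _](bigID (fun u : 'I_t => xvisible f idx s t v u))/=.
set S1 := \sum_(u < t | _) _; set S2 := \sum_(u < t | ~~ _) _.
have -> : x0 0 v - gamma * S1 - (x0 0 v - gamma * (S1 + S2)) = gamma * S2 by ring.
rewrite normrM (ger0_norm gamma_ge0) ler_wpM2l//.
apply: (le_trans (ler_norm_sum _ _ _)).
rewrite big_mkcond [leRHS]big_mkcond/=; apply: ler_sum => u _.
case: ifP => [nvis|_]; last by case: ifP.
case: leqP => // ut; have vS : v \notin supp f (idx u).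
  apply: contra nvis => vS; rewrite /xvisible vS/=.
  have /andP[_ h1] := time_xwrite (run_valid run) vS.
  have /andP[h2 _] := time_xread (run_valid run) t v.
  by apply: (le_lt_trans h1 (lt_le_trans (finish_before_start _) h2)); lia.
by rewrite dir_notin_supp// normr0.
Qed.

(** Indicator that [j] is not drawn by iterations [r, ..., r + k - 1], written as a product so that
    expectations can be taken one factor at a time. *)
Definition unsampled (idx : nat -> 'I_n) (j : 'I_n) (r k : nat) : R :=
  \prod_(m < k) (idx (r + m)%N != j)%:R.

Lemma unsampled_ge0 j r k : 0 <= unsampled idx j r k.
Proof. by apply: prodr_ge0 => m _; exact: ler0n. Qed.

Lemma unsampled1 j r k :
  (forall m, (r <= m < r + k)%N -> idx m != j) -> unsampled idx j r k = 1.
Proof. by move=> h; rewrite /unsampled big1// => m _; rewrite h//; have := ltn_ord m; lia. Qed.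

(* A cell value written by iteration u and still read by t cannot have been
   overwritten by any w in [u + tau + 1, t - tau - 1], as such a w starts after
   u is finished and is finished before t starts. *)
Lemma memory_bound (y : 'rV[R]_d) t j : (forall v, v \notin supp f j -> y 0 v = 0) ->
  dot (ah t j - y) (ah t j - y) <=
  (\sum_(u < t) (idx u == j)%:R * unsampled idx j (u + tau + 1) (t - 2 * tau - u - 1)
    * dot (grad (f j) (xh u) - y) (grad (f j) (xh u) - y))
  + unsampled idx j 0 (t - tau) * dot (alpha0 j - y) (alpha0 j - y).
Proof.
move=> y0; have V := run_valid run.
have sq (b : R) : b * b = b ^+ 2 by rewrite expr2.
have subE (a b : 'rV[R]_d) k : (a - b) 0 k = a 0 k - b 0 k by rewrite !mxE.
(* The proof is coordinatewise: with inconsistent reads, different coordinates of one cell may come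
   from different iterations [u], whence the sum over all [u]. *)
under eq_bigr do rewrite /dot mulr_sumr.
rewrite exchange_big/= /dot mulr_sumr -big_split/=; apply: ler_sum => v _.
set B := \sum_(u < t) _.
have B0 : 0 <= B.
  by apply: sumr_ge0 => u _; rewrite sq mulr_ge0 ?sqr_ge0// mulr_ge0// unsampled_ge0.
have [vS|vS] := boolP (v \in supp f j); last first.
  rewrite !mxE memory_notin_supp// y0// subrr mul0r addr_ge0// mulr_ge0 ?unsampled_ge0//.
  by rewrite alpha0_supp// subrr mul0r.
have [[novis ahE]|[u [uvis umax ahE]]] := run_alpha run t j v.
  (* The initial value is read here: a sampling of [j] by some [m < t - tau] would have left a
     visible write. *)
  rewrite unsampled1 => [|m /= mt]; last first.
    apply/negP => /eqP mj; have vS' : v \in supp f (idx m) by rewrite mj.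
    have := novis m; rewrite /avisible mj eqxx vS.
    have -> : (m < t)%N by lia.
    rewrite /= => /negP; apply.
    have /andP[_ h1] := time_awrite V vS'; have /andP[h2 _] := time_aread V t j v.
    by apply: (le_lt_trans h1 (lt_le_trans (finish_before_start _) h2)); lia.
  by rewrite mul1r !mxE ahE lerDr.
have := uvis; rewrite /avisible => /and4P[ut /eqP uj _ _].
have ns : unsampled idx j (u + tau + 1) (t - 2 * tau - u - 1) = 1.
  apply: unsampled1 => m mt; apply/negP => /eqP mj.
  have vSm : v \in supp f (idx m) by rewrite mj.
  have vSu : v \in supp f (idx u) by rewrite uj.
  have /andP[m1 m2] := time_awrite V vSm; have /andP[_ u2] := time_awrite V vSu.
  have /andP[h2 _] := time_aread V t j v; have /andP[h3 _] := time_phases V m.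
  have [um mt' ltmt] := window_bounds mt.
  have F1 : finish s u < start s m by exact: finish_before_start.
  have F2 : finish s m < start s t by exact: finish_before_start.
  have mvis : avisible f idx s t j v m.
    by rewrite /avisible mj eqxx vS (le_lt_trans m2 (lt_le_trans F2 h2)) ltmt.
  have := umax m mvis; rewrite leNgt => /negP; apply.
  by rewrite (le_lt_trans u2)// (lt_le_trans F1)// (le_trans h3).
apply: (@le_trans _ _ B); last first.
  by rewrite lerDl mulr_ge0 ?unsampled_ge0// sq sqr_ge0.
rewrite /B (bigD1 (Ordinal ut))//= uj eqxx ns !mul1r !subE ahE lerDl.
by apply: sumr_ge0 => w _; rewrite sq mulr_ge0 ?sqr_ge0// mulr_ge0// unsampled_ge0.
Qed.

End schedule.

(** * Weighted sums and the error recursion *)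

Section geometric_sums.
Context {R : realFieldType}.
Implicit Types (r q : R) (k M T : nat).

(** Truncated subtraction makes the first [k] terms equal to 1; the rest is a geometric series. *)
Lemma sum_geom_trunc r k M : 0 <= r < 1 ->
  \sum_(m < M) r ^+ (m - k) <= k%:R + (1 - r)^-1.
Proof.
case/andP => r0 r1; elim: k M => [|k IH] [|M].
- by rewrite big_ord0 add0r invr_ge0 subr_ge0 ltW.
- rewrite add0r (eq_bigr (fun m : 'I__ => r ^+ m)) => [|m _]; last by rewrite subn0.
  have := subrX1 r M.+1; rewrite -(opprB 1 r) mulNr => /eqP.
  rewrite -eqr_oppLR opprB => /eqP h.
  have r1' : 0 < 1 - r by rewrite subr_gt0.
  by rewrite -(ler_pM2l r1') -h divff ?gt_eqF// gerBl exprn_ge0.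
- by rewrite big_ord0 addr_ge0// invr_ge0 subr_ge0 ltW.
rewrite big_ord_recl/= sub0n expr0 -natr1 [_ + 1]addrC -addrA lerD2l.
rewrite (eq_bigr (fun m : 'I__ => r ^+ (m - k))); first exact: IH.
by move=> m _; rewrite /bump leq0n add1n subSS.
Qed.

Lemma triangle_sum (F : nat -> nat -> R) T :
  \sum_(t < T) \sum_(u < t) F t u =
  \sum_(u < T) \sum_(m < T - u - 1) F (u + 1 + m)%N u.
Proof.
elim: T => [|T IH]; first by rewrite !big_ord0.
rewrite !big_ord_recr/= IH subSn// subnn subnn big_ord0 addr0 -big_split/=.
apply: eq_bigr => u _; have uT := ltn_ord u.
have -> : (T.+1 - u - 1 = (T - u - 1).+1)%N by lia.
rewrite big_ord_recr/=; congr (_ + F _ _); lia.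
Qed.

(** With [t = u + 1 + m] the weight splits as [w ^+ u.+1 * w ^+ m.+1], so exchanging the sums leaves
    the weighted mass of the kernel as a factor. *)
Lemma weighted_convolution (w : R) (K y : nat -> R) (B : R) T :
  0 <= w -> (forall u, 0 <= y u) ->
  (forall M, \sum_(m < M) w ^+ m.+1 * K m <= B) ->
  \sum_(t < T) w ^+ t.+1 * \sum_(u < t) K (t - u - 1)%N * y u <=
  B * \sum_(u < T) w ^+ u.+1 * y u.
Proof.
move=> w0 y0 KB.
under eq_bigr do rewrite mulr_sumr.
rewrite (triangle_sum (fun t u => w ^+ t.+1 * (K (t - u - 1)%N * y u))) mulr_sumr.
apply: ler_sum => u _; have wy : 0 <= w ^+ u.+1 * y u by rewrite mulr_ge0 ?exprn_ge0.
apply: le_trans (ler_wpM2r wy (KB (T - u - 1)%N)).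
rewrite mulr_suml; apply: ler_sum => m _.
have -> : (u + 1 + m - u - 1 = m)%N by lia.
have -> : ((u + 1 + m).+1 = u.+1 + m.+1)%N by lia.
by rewrite exprD; lra.
Qed.

Lemma bernoulli_ge (r : R) k : 0 <= r <= 1 -> 1 - k%:R * r <= (1 - r) ^+ k.
Proof.
case/andP => r0 r1; elim: k => [|k IH]; first by rewrite expr0 mul0r subr0.
rewrite exprS.
have : (1 - r) * (1 - k%:R * r) <= (1 - r) * (1 - r) ^+ k.
  by rewrite ler_wpM2l// subr_ge0.
apply: le_trans; rewrite -natr1 -subr_ge0.
have -> : (1 - r) * (1 - k%:R * r) - (1 - (k%:R + 1) * r) = k%:R * r ^+ 2 by ring.
by rewrite mulr_ge0 ?sqr_ge0.
Qed.

Lemma sum_window (tau M : nat) : (\sum_(m < M) (m < tau) <= tau)%N.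
Proof.
suff -> : (\sum_(m < M) (m < tau) = minn M tau)%N by rewrite geq_minr.
elim: M => [|M IH]; first by rewrite big_ord0 min0n.
by rewrite big_ord_recr/= IH; case: ltnP; lia.
Qed.

End geometric_sums.

Lemma window_ltn (t u tau : nat) : (u < t)%N ->
  (t - u - 1 < tau)%N = (t <= u + tau)%N.
Proof. lia. Qed.

Lemma subn_window (t u tau : nat) :
  (t - u - 1 - 2 * tau = t - 2 * tau - u - 1)%N.
Proof. lia. Qed.

(** * The error recursion for real sequences *)

Section recursion.
Context {R : realFieldType} (n tau : nat) (aa e G : nat -> R).
Context (L mu gamma A e0 rho : R).
Let C1 := 1 + tau%:R * A.
Let C2 := A + gamma * mu * C1.
Let q : R := 1 - n%:R^-1.

Hypothesis n_gt0 : (0 < n)%N.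
Hypothesis tau_lt : tau%:R < n%:R / 10 :> R.
Hypothesis aa_ge0 : forall t, 0 <= aa t.
Hypothesis e_ge0 : forall t, 0 <= e t.
Hypothesis G_ge0 : forall t, 0 <= G t.
Hypothesis e0_ge0 : 0 <= e0.
Hypothesis L_gt0 : 0 < L.
Hypothesis mu_gt0 : 0 < mu.
Hypothesis gamma_gt0 : 0 < gamma.
Hypothesis A_ge0 : 0 <= A.
Hypothesis rho_ge0 : 0 <= rho.
Hypothesis rho_n : rho <= 5^-1 * n%:R^-1.
Hypothesis rho_mu : rho <= gamma * mu / 2.
(* 50/49 bounds (1 - rho)^-tau, since tau rho <= 1/50. *)
Hypothesis step : gamma * L * (C1 + 50 / 49 * C2 * tau%:R) <= 3 / 40.
Hypothesis aa_rec : forall t, aa t.+1 <= (1 - gamma * mu / 2) * aa t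
  - 2 * gamma * e t + gamma ^+ 2 * C1 * G t
  + gamma ^+ 2 * C2 * \sum_(u < t | (t <= u + tau)%N) G u.
Hypothesis G_bound : forall t, G t <= 4 * L * e t
  + 4 * L / n%:R * \sum_(u < t) q ^+ (t - 2 * tau - u - 1) * e u
  + 4 * L * q ^+ (t - tau) * e0.

Let nR_gt0 : 0 < n%:R :> R. Proof. by rewrite ltr0n. Qed.
Let nV_gt0 : 0 < n%:R^-1 :> R. Proof. by rewrite invr_gt0. Qed.
Let nV_le1 : n%:R^-1 <= 1 :> R.
Proof. by rewrite invf_le1// ler1n. Qed.
Let rho_le : rho <= 5^-1. Proof. have := nV_le1; have := rho_n; lra. Qed.
Let s := 1 - rho.
Let w := s^-1.
Ltac slra := move: (rho_le) (rho_ge0) (rho_n) (rho_mu) (nV_gt0) (nR_gt0) (tau_lt); lra.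
Let s_gt0 : 0 < s. Proof. by rewrite /s; slra. Qed.
Let w_ge1 : 1 <= w. Proof. by rewrite invf_ge1// /s; slra. Qed.
Let w_gt0 : 0 < w. Proof. exact: lt_le_trans w_ge1. Qed.
Let w_le : w <= 5 / 4.
Proof. by rewrite -[5/4]invrK lef_pV2 ?posrE// /s; slra. Qed.

(** Bernoulli: [(1 - rho) ^+ k] is at least [1 - k rho], hence at least [1 - c / 5]. The values
    [c = 1/10] and [c = 1/5] give the bounds 50/49 for [tau] and 25/24 for [2 * tau]. *)
Let wX_le (k : nat) (c b : R) : k%:R <= c * n%:R -> 0 <= c <= 1 -> 0 <= b ->
  1 <= b * (1 - c / 5) -> w ^+ k <= b.
Proof.
move=> kc /andP[c0 c1] b0 bc; rewrite exprVn -div1r ler_pdivrMr ?exprn_gt0//.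
apply: (le_trans bc); rewrite ler_wpM2l//.
apply: le_trans (@bernoulli_ge _ rho k _); last by rewrite rho_ge0; slra.
have : k%:R * rho <= c * n%:R * (5^-1 * n%:R^-1) by rewrite ler_pM.
have -> : c * n%:R * (5^-1 * n%:R^-1) = c / 5 by field; rewrite gt_eqF.
slra.
Qed.

Let q_ge0 : 0 <= q. Proof. by rewrite subr_ge0. Qed.

(** Splitting off [w ^+ k.+1] leaves a truncated geometric sum of ratio [w * q]. Its tail gives
    [1 / (s - q)], at most [5 n / 4] by the gap between [s] and [q]; its first [k] terms use
    [w <= 5/4]. *)
Let geom_bound (k M : nat) :
  \sum_(m < M) w ^+ m.+1 * q ^+ (m - k) <= w ^+ k * (5 / 4 * k%:R + 5 / 4 * n%:R).
Proof.
have sq : 0 < s - q by rewrite /s /q; slra.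
have wq : 0 <= w * q < 1.
  apply/andP; split; first by rewrite mulr_ge0// ltW.
  by rewrite mulrC ltr_pdivrMr// mul1r -subr_gt0.
have H := @sum_geom_trunc _ _ k M wq.
have : w ^+ k.+1 * \sum_(m < M) (w * q) ^+ (m - k) <= w ^+ k.+1 * (k%:R + (1 - w * q)^-1).
  by rewrite ler_wpM2l// exprn_ge0// ltW.
move=> {H} H; apply: (le_trans _ (le_trans H _)).
  rewrite mulr_sumr; apply: ler_sum => m _; rewrite exprMn mulrA -exprD.
  rewrite ler_wpM2r ?exprn_ge0// ler_weXn2l//.
  by rewrite addSn ltnS -leq_subLR.
rewrite exprSr -mulrA ler_wpM2l ?exprn_ge0 ?(ltW w_gt0)// mulrDr lerD//.
  by rewrite ler_wpM2r.
have -> : w * (1 - w * q)^-1 = (s - q)^-1.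
  by rewrite /w; field; rewrite !gt_eqF.
rewrite -[leRHS]invrK lef_pV2 ?posrE//; last by rewrite invr_gt0 mulr_gt0//; slra.
rewrite invfM /s /q; slra.
Qed.

Let Z T := \sum_(u < T) w ^+ u.+1 * e u.
Let Y T := \sum_(u < T) w ^+ u.+1 * G u.

Let Z_ge0 T : 0 <= Z T.
Proof. by apply: sumr_ge0 => u _; rewrite mulr_ge0 ?exprn_ge0// ltW. Qed.

(** The distances telescope because [rho <= gamma * mu / 2] makes [w * (1 - gamma * mu / 2)] at most
    1. *)
Let unrolled T : w ^+ T * aa T <= aa 0 - 2 * gamma * Z T + gamma ^+ 2 * C1 * Y T
  + gamma ^+ 2 * C2 * \sum_(t < T) w ^+ t.+1 * \sum_(u < t | (t <= u + tau)%N) G u.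
Proof.
elim: T => [|T IH]; first by rewrite /Z /Y !big_ord0 expr0 !mulr0 !addr0 subr0 mul1r.
rewrite /Z /Y !big_ord_recr/= -/(Z T) -/(Y T).
set S := \sum_(t < T) _ in IH *; set S' := \sum_(u < T | _) _.
have wT : 0 <= w ^+ T.+1 by rewrite exprn_ge0// ltW.
have := ler_wpM2l wT (aa_rec T); rewrite -/S' => H.
have : w ^+ T.+1 * ((1 - gamma * mu / 2) * aa T) <= w ^+ T * aa T.
  have wmu : w * (1 - gamma * mu / 2) <= 1.
    by rewrite mulrC ler_pdivrMr// mul1r /s; slra.
  have wa : 0 <= w ^+ T * aa T by rewrite mulr_ge0// exprn_ge0// ltW.
  have := ler_wpM2l wa wmu; rewrite exprS mulr1; apply: le_trans.
  by rewrite le_eqVlt; apply/orP; left; apply/eqP; ring.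
move: IH H; set W := w ^+ T.+1; set V := w ^+ T * aa T; lra.
Qed.

Let window_bound T :
  \sum_(t < T) w ^+ t.+1 * \sum_(u < t | (t <= u + tau)%N) G u <=
  50 / 49 * tau%:R * Y T.
Proof.
have wtau : w ^+ tau <= 50 / 49.
  apply: (@wX_le tau (1 / 10)); slra.
have H : forall M, \sum_(m < M) w ^+ m.+1 * (m < tau)%:R <= 50 / 49 * tau%:R.
  move=> M; apply: (@le_trans _ _ (\sum_(m < M) 50 / 49 * (m < tau)%:R)).
    apply: ler_sum => m _; case: ltnP => mt; last by rewrite !mulr0.
    by rewrite !mulr1 (le_trans _ wtau)// ler_weXn2l.
  rewrite -mulr_sumr ler_wpM2l// -natr_sum ler_nat; exact: sum_window.
apply: le_trans (@weighted_convolution _ w (fun m => (m < tau)%:R) G _ T (ltW w_gt0) G_ge0 H).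
apply: ler_sum => t _; rewrite ler_wpM2l ?exprn_ge0 ?(ltW w_gt0)//.
rewrite big_mkcond/=; apply: ler_sum => u _ /=; have ut := ltn_ord u.
rewrite (window_ltn tau ut).
by case: ifP; rewrite ?mul1r ?mul0r.
Qed.

(** The memory kernel has weighted mass at most [25/24 * (3/2 * n) = 25/16 * n], and
    [41/16 = 1 + 25/16] adds the term at time [t] itself. *)
Let Y_bound T : Y T <= 4 * L * (41 / 16 * Z T + 2 * n%:R * e0).
Proof.
have w2 : w ^+ (2 * tau) <= 25 / 24.
  by apply: (@wX_le (2 * tau) (1 / 5)); rewrite ?natrM; slra.
have w1 : w ^+ tau <= 50 / 49.
  apply: (@wX_le tau (1 / 10)); slra.
have H2 M : \sum_(m < M) w ^+ m.+1 * q ^+ (m - 2 * tau) <= 25 / 16 * n%:R.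
  apply: (le_trans (geom_bound _ _)).
  apply: (@le_trans _ _ (25 / 24 * (3 / 2 * n%:R))); last by slra.
  apply: ler_pM => //; first by rewrite exprn_ge0// ltW.
  by rewrite natrM; slra.
have H1 M : \sum_(m < M) w ^+ m.+1 * q ^+ (m - tau) <= 2 * n%:R.
  apply: (le_trans (geom_bound _ _)).
  apply: (@le_trans _ _ (50 / 49 * (11 / 8 * n%:R))); last by slra.
  apply: ler_pM => //; first by rewrite exprn_ge0// ltW.
  slra.
have C := @weighted_convolution _ w (fun m => q ^+ (m - 2 * tau)) e _ T (ltW w_gt0) e_ge0 H2.
rewrite /= in C.
have {}H1 := H1 T.
apply: (@le_trans _ _ (4 * L * (Z T
  + n%:R^-1 * (\sum_(t < T) w ^+ t.+1 * \sum_(u < t) q ^+ (t - u - 1 - 2 * tau) * e u)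
  + (\sum_(t < T) w ^+ t.+1 * q ^+ (t - tau)) * e0))).
  rewrite /Y /Z mulr_suml [n%:R^-1 * _]mulr_sumr -!big_split/= mulr_sumr.
  apply: ler_sum => t _.
  have := ler_wpM2l (exprn_ge0 t.+1 (ltW w_gt0)) (G_bound t).
  under [in X in _ -> _ <= X]eq_bigr => u _.
    rewrite subn_window.
  over.
  move/le_trans; apply; set S := \sum_(u < t) _; rewrite le_eqVlt; apply/orP; left.
  by apply/eqP; ring.
rewrite ler_wpM2l//; first by rewrite mulr_ge0// ltW.
apply: lerD; last by rewrite ler_wpM2r.
have := ler_wpM2l (ltW nV_gt0) C; rewrite -/(Z T) => {}C.
have -> : 41 / 16 * Z T = Z T + n%:R^-1 * (25 / 16 * n%:R * Z T).
  by field; rewrite gt_eqF.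
by rewrite lerD2l.
Qed.

(** By [step], the second moments cost at most [4 * 3/40 * 41/16 < 1] times [gamma * Z], so one of
    the two copies of [gamma * Z] survives; its last term alone is then kept. *)
Lemma recursion_bound T : gamma * e T <= s ^+ T.+1 * (aa 0 + gamma * n%:R * e0).
Proof.
have U := unrolled T.+1; have W := window_bound T.+1; have YB := Y_bound T.+1.
have C10 : 0 <= C1 by rewrite addr_ge0// mulr_ge0.
have C20 : 0 <= C2 by rewrite addr_ge0// !mulr_ge0// ltW.
have g2 : 0 <= gamma ^+ 2 * C2 by rewrite mulr_ge0// sqr_ge0.
have {}W := ler_wpM2l g2 W.
have wa : 0 <= w ^+ T.+1 * aa T.+1 by rewrite mulr_ge0// exprn_ge0// ltW.
set Q := C1 + 50 / 49 * C2 * tau%:R.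
have stepQ : gamma * L * Q <= 3 / 40 := step.
have Q0 : 0 <= Q by rewrite addr_ge0// !mulr_ge0//.
set YT := Y T.+1 in U W YB; set ZT := Z T.+1 in U YB.
have ZT0 : 0 <= ZT by exact: Z_ge0.
have H1 : 2 * gamma * ZT <= aa 0 + gamma ^+ 2 * Q * YT by rewrite /Q; lra.
have H2 : gamma ^+ 2 * Q * YT <= gamma * (ZT + n%:R * e0).
  have gQ : 0 <= gamma ^+ 2 * Q by rewrite mulr_ge0// sqr_ge0.
  apply: (le_trans (ler_wpM2l gQ YB)).
  set X := 41 / 16 * ZT + 2 * n%:R * e0.
  have ne0 : 0 <= n%:R * e0 by rewrite mulr_ge0.
  have X0 : 0 <= X by rewrite /X; lra.
  have -> : gamma ^+ 2 * Q * (4 * L * X) = gamma * (gamma * L * Q * (4 * X)) by ring.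
  rewrite ler_pM2l//.
  have : gamma * L * Q * (4 * X) <= 3 / 40 * (4 * X) by rewrite ler_wpM2r// mulr_ge0.
  by rewrite /X; lra.
have H3 : gamma * ZT <= aa 0 + gamma * n%:R * e0 by lra.
have H4 : w ^+ T.+1 * e T <= ZT.
  rewrite /ZT /Z big_ord_recr/= lerDr; exact: Z_ge0.
have := ler_wpM2l (ltW gamma_gt0) H4 => {}H4.
have {}H4 := le_trans H4 H3.
have sT : 0 < s ^+ T.+1 by rewrite exprn_gt0.
rewrite -(ler_pM2l sT) in H4; apply: le_trans H4.
by rewrite /w exprVn mulrCA mulrA mulrA mulfK ?gt_eqF// mulrC.
Qed.

End recursion.

(** With [gamma * L = a] and [gamma * mu = a / kappa] this is the hypothesis [step] of the
    recursion. The three terms of the expansion are at most 1/32, 50/49 of 1/32 and 50/49 of 1/128,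
    in total less than 3/40. *)
Lemma astar_step (R : realType) (kappa D a : R) (tau : nat) :
  0 < kappa -> 0 < D -> 0 < a <= astar kappa D tau ->
  a <= 1 / 32 /\
  a * (1 + tau%:R * Num.sqrt D + 50 / 49 *
    (Num.sqrt D + a / kappa * (1 + tau%:R * Num.sqrt D)) * tau%:R) <= 3 / 40.
Proof.
move=> k0 D0 /andP[a0].
have A0 : 0 < Num.sqrt D by rewrite sqrtr_gt0.
rewrite /astar; set A := Num.sqrt D in A0 *.
set X := xi _ _ _; set M := Num.min A^-1 tau%:R.
have M0 : 0 <= M by rewrite le_min invr_ge0 ltW//=.
have XX : X ^+ 2 = 1 + (8 * kappa)^-1 * M.
  by rewrite sqr_sqrtr// addr_ge0// mulr_ge0// invr_ge0 mulr_ge0// ltW.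
have X0 : 0 <= X by exact: sqrtr_ge0.
have X1 : 1 <= X.
  rewrite -(@ler_pXn2r _ 2)// ?nnegrE// XX expr1n lerDl mulr_ge0// invr_ge0.
  by rewrite mulr_ge0// ltW.
set C := 1 + tau%:R * A.
have tA : 0 <= tau%:R * A by rewrite mulr_ge0// ltW.
have C1 : 1 <= C by rewrite lerDl.
(* The origin of the minimum in [xi]: both [C / A = A^-1 + tau] and [C * tau] are at least [tau]. *)
have tM : tau%:R <= C * M.
  rewrite /M minEle; case: ifP => _.
    by rewrite mulrDl mul1r mulfK ?gt_eqF// lerDr invr_ge0 ltW.
  by rewrite ler_peMl.
have XCp : 0 < 32 * C * X by rewrite !mulr_gt0//; lra.
rewrite -[a in a <= _]invrK lef_pV2 ?posrE ?invr_gt0// => H'.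
have := ler_wpM2l (ltW a0) H'; rewrite divff ?gt_eqF// => H.
have aC : a * C <= 1 / 32.
  have : a * C * 1 <= a * C * X by rewrite ler_wpM2l// mulr_ge0//; lra.
  lra.
have a32 : a <= 1 / 32.
  have : a * 1 <= a * C by rewrite ler_wpM2l// ltW.
  lra.
split => //.
(* a C M / kappa <= xi / 4, by 32 a C xi <= 1 and M / kappa = 8 (xi ^ 2 - 1). *)
have atk : a * C * (a / kappa * tau%:R) <= 1 / 128.
  have k1 : 0 < a / kappa by rewrite divr_gt0.
  have T1 : a / kappa * tau%:R <= a / kappa * (C * M) by rewrite ler_wpM2l// ltW.
  have MX : M / kappa = 8 * (X ^+ 2 - 1) by rewrite XX; field; rewrite gt_eqF.
  have aC0 : 0 <= a * C by rewrite mulr_ge0//; lra.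
  have := ler_wpM2l aC0 T1.
  have -> : a * C * (a / kappa * (C * M)) = (a * C) ^+ 2 * (M / kappa) by ring.
  rewrite MX => T2; apply: (le_trans T2).
  have T3 : (a * C * X) ^+ 2 <= (1 / 32) ^+ 2.
    by rewrite ler_pXn2r ?nnegrE ?mulr_ge0//; lra.
  have := sqr_ge0 (a * C); lra.
have : a * (A * tau%:R) <= a * C by rewrite ler_wpM2l ?(ltW a0)// /C; lra.
have -> : a * (C + 50 / 49 * (A + a / kappa * C) * tau%:R) =
  a * C + 50 / 49 * (a * (A * tau%:R)) + 50 / 49 * (a * C * (a / kappa * tau%:R)) by ring.
lra.
Qed.

(** * Finitely valued random variables *)

Section discrete.
Context {T : pointedType} (F : set (set T)).
Hypothesis F_sigma : sigma_algebra [set: T] F.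

(** With a finite range, level sets in [F] put every preimage in [F]. The class is thus closed under
    composition with arbitrary functions, gradients included, and its real members are bounded. *)
Definition discrete_wrt (U : Type) (X : T -> U) : Prop :=
  finite_set (range X) /\ forall y, F (X @^-1` [set y]).

Let FE (A : set T) : measurable (A : set (g_sigma_algebraType F)) = F A.
Proof. by rewrite measurable_g_measurableTypeE. Qed.

Lemma discrete_preimage (U : Type) (X : T -> U) (B : set U) :
  discrete_wrt X -> F (X @^-1` B).
Proof.
case=> Xfin XF.
have -> : X @^-1` B = \bigcup_(y in range X `&` B) X @^-1` [set y].
  apply/seteqP; split => [w Bw|w [y [_ By] /= Xy]]; last by rewrite /= Xy.
  by exists (X w) => //; split => //; exists w.
rewrite -FE; apply: fin_bigcup_measurable.
  by apply: sub_finite_set Xfin; exact: subIsetl.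
by move=> y _; rewrite FE.
Qed.

Lemma discrete_comp (U V : Type) (phi : U -> V) (X : T -> U) :
  discrete_wrt X -> discrete_wrt (fun w => phi (X w)).
Proof.
move=> dX; split; last first.
  move=> y; exact: (discrete_preimage [set x | phi x = y] dX).
have -> : range (fun w => phi (X w)) = phi @` range X by rewrite image_comp.
by apply: finite_image; case: dX.
Qed.

Lemma discrete_pair (U V : Type) (X : T -> U) (Y : T -> V) :
  discrete_wrt X -> discrete_wrt Y -> discrete_wrt (fun w => (X w, Y w)).
Proof.
move=> [Xf XF] [Yf YF]; split.
  apply: sub_finite_set (finite_setX Xf Yf) => _ [w _ <-] /=.
  by split; exists w.
move=> [x y]; have -> : (fun w => (X w, Y w)) @^-1` [set (x, y)] =
    X @^-1` [set x] `&` Y @^-1` [set y].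
  by apply/seteqP; split => w /= => [[-> ->]|[-> ->]].
by rewrite -FE; apply: measurableI; rewrite FE.
Qed.

Lemma discrete_comp2 (U V W : Type) (phi : U -> V -> W) (X : T -> U) (Y : T -> V) :
  discrete_wrt X -> discrete_wrt Y -> discrete_wrt (fun w => phi (X w) (Y w)).
Proof.
move=> dX dY; exact: (discrete_comp (fun p => phi p.1 p.2) (discrete_pair dX dY)).
Qed.

Lemma discrete_cst (U : Type) (c : U) : discrete_wrt (fun=> c).
Proof.
split; first by apply: sub_finite_set (finite_set1 c) => _ [w _ <-].
move=> y; rewrite -FE; have [->|cy] := pselect (c = y).
  by rewrite (_ : _ @^-1` _ = setT)//; apply/seteqP; split.
by rewrite (_ : _ @^-1` _ = set0)//; apply/seteqP; split.
Qed.

Lemma discrete_mem (A : set T) : F A -> discrete_wrt (fun w => w \in A).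
Proof.
move=> FA; split=> [|b]; first exact: finite_finset.
have -> : (fun w => w \in A) @^-1` [set b] = if b then A else ~` A.
  case: b; apply/seteqP; split=> w /=.
  - by move/set_mem.
  - by move/mem_set.
  - by move=> Aw /mem_set; rewrite Aw.
  - by move=> Aw; rewrite memNset.
by rewrite -FE; case: b; [|apply: measurableC]; rewrite FE.
Qed.

Lemma discrete_sum (V : nmodType) (I : Type) (r : seq I) (P : pred I)
    (X : I -> T -> V) : (forall i, P i -> discrete_wrt (X i)) ->
  discrete_wrt (fun w => \sum_(i <- r | P i) X i w).
Proof.
move=> dX; elim: r => [|i r IH].
  by under eq_fun do rewrite big_nil; exact: discrete_cst.
under eq_fun do rewrite big_cons.
case: (boolP (P i)) => // Pi.
by apply: (discrete_comp2 (fun a b : V => a + b)) => //; exact: dX.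
Qed.

Lemma discrete_prod (R : pzSemiRingType) (I : Type) (r : seq I) (X : I -> T -> R) :
  (forall i, discrete_wrt (X i)) ->
  discrete_wrt (fun w => \prod_(i <- r) X i w).
Proof.
move=> dX; elim: r => [|i r IH].
  by under eq_fun do rewrite big_nil; exact: discrete_cst.
under eq_fun do rewrite big_cons.
by apply: (discrete_comp2 (fun a b : R => a * b)).
Qed.

End discrete.

Lemma sub_discrete (T : pointedType) (U : Type) (F G : set (set T)) (X : T -> U) :
  F `<=` G -> discrete_wrt F X -> discrete_wrt G X.
Proof. by move=> FG [fX mX]; split => // y; exact/FG/mX. Qed.

Section expectation.
Context {disp : measure_display} {T : measurableType disp} {R : realType}.
Context (P : probability T R).
Implicit Types X Y : T -> R.

Definition discrete_rv (U : Type) (X : T -> U) := discrete_wrt (@measurable _ T) X.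

Definition Ex X : R := (\int[P]_w X w)%R.

Let meas_sigma : sigma_algebra [set: T] (@measurable _ T).
Proof. exact: sigma_algebra_measurable. Qed.

Lemma discrete_integrable X : discrete_rv X -> P.-integrable setT (EFin \o X).
Proof.
move=> dX; apply: measurable_bounded_integrable => //.
- by apply: (le_lt_trans (@probability_le1 _ _ _ P setT _)) => //; exact: ltry.
- move=> _ B _; rewrite setTI.
  exact: (discrete_preimage meas_sigma B dX).
have [s sE] := (finite_seqP _).1 dX.1.
exists (\sum_(x <- s) `|x|); split; first exact: num_real.
move=> M sM w _ /=; apply: le_trans (ltW sM).
have ws : X w \in s by have : [set` s] (X w) by rewrite -sE; exists w.
rewrite (big_rem _ ws)/= lerDl.
by apply: sumr_ge0 => x _; exact: normr_ge0.
Qed.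

Lemma expectation_Ex X : discrete_rv X -> ('E_P[X] = (Ex X)%:E)%E.
Proof.
move=> dX; rewrite unlock /Ex /Rintegral fineK//.
by apply: integrable_fin_num => //; exact: discrete_integrable.
Qed.

Lemma Ex_ge0 X : (forall w, 0 <= X w) -> 0 <= Ex X.
Proof. by move=> X0; apply: Rintegral_ge0 => w _. Qed.

Lemma Ex_le X Y : discrete_rv X -> discrete_rv Y -> (forall w, X w <= Y w) ->
  Ex X <= Ex Y.
Proof.
by move=> dX dY XY; apply: le_Rintegral => //; exact: discrete_integrable.
Qed.

Lemma ExD X Y : discrete_rv X -> discrete_rv Y ->
  Ex (fun w => X w + Y w) = Ex X + Ex Y.
Proof. by move=> dX dY; rewrite /Ex RintegralD//; exact: discrete_integrable. Qed.

Lemma ExB X Y : discrete_rv X -> discrete_rv Y ->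
  Ex (fun w => X w - Y w) = Ex X - Ex Y.
Proof. by move=> dX dY; rewrite /Ex RintegralB//; exact: discrete_integrable. Qed.

Lemma ExZ c X : discrete_rv X -> Ex (fun w => c * X w) = c * Ex X.
Proof. by move=> dX; rewrite /Ex RintegralZl//; exact: discrete_integrable. Qed.

Lemma Ex_cst c : Ex (fun=> c) = c.
Proof.
by rewrite /Ex Rintegral_cst// -[fine _]/(fine (P setT)) probability_setT mulr1.
Qed.

Lemma Ex_sum (I : Type) (r : seq I) (Q : pred I) (X : I -> T -> R) :
  (forall i, Q i -> discrete_rv (X i)) ->
  Ex (fun w => \sum_(i <- r | Q i) X i w) = \sum_(i <- r | Q i) Ex (X i).
Proof.
move=> dX; elim: r => [|i r IH].
  by rewrite big_nil; under eq_fun do rewrite big_nil; exact: Ex_cst.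
rewrite big_cons; under eq_fun do rewrite big_cons.
case: ifP => // Qi; rewrite -IH ExD//; first exact: dX.
by apply: discrete_sum => //; exact: meas_sigma.
Qed.

Lemma Ex_indic (A : set T) : measurable A -> Ex (\1_A) = fine (P A).
Proof. by move=> mA; rewrite /Ex /Rintegral integral_indic// setIT. Qed.

(** [X] is a finite combination of indicators of its level sets, and independence applies to each of
    them. *)
Lemma Ex_independent (F : set (set T)) X (B : set T) :
  sigma_algebra [set: T] F -> F `<=` @measurable _ T -> measurable B ->
  (forall A, F A -> P (A `&` B) = (P A * P B)%E) -> discrete_wrt F X ->
  Ex (fun w => X w * \1_B w) = Ex X * fine (P B).
Proof.
move=> sF FM mB ind dX.
have [s sE] := (finite_seqP _).1 dX.1.
(* Duplicates are removed so that exactly one indicator is nonzero. *)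
have XE : X = fun w => \sum_(x <- undup s) x * \1_(X @^-1` [set x]) w.
  apply/funext => w; have ws : X w \in undup s.
    by rewrite mem_undup; have : [set` s] (X w) by rewrite -sE; exists w.
  rewrite (bigD1_seq (X w)) ?undup_uniq//= indicE mem_set// mulr1.
  rewrite big1 ?addr0// => x xX; rewrite indicE memNset ?mulr0// => /= e.
  by rewrite e eqxx in xX.
have FX x : F (X @^-1` [set x]) by exact: dX.2.
have dI (A : set T) : measurable A -> discrete_rv (\1_A : T -> R).
  move=> /(discrete_mem meas_sigma) dA.
  exact: (discrete_comp meas_sigma (fun b : bool => b%:R) dA).
have dZ (x : R) (A : set T) : measurable A ->
    discrete_rv (fun w => x * (\1_A w : R)).
  by move=> /dI dA; exact: (discrete_comp meas_sigma ( *%R x) dA).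
rewrite [in RHS]XE Ex_sum => [|x _]; last by apply: dZ; exact/FM/FX.
have -> : (fun w => X w * \1_B w) =
    fun w => \sum_(x <- undup s) x * \1_(X @^-1` [set x] `&` B) w.
  apply/funext => w; rewrite {1}XE mulr_suml; apply: eq_bigr => x _.
  by rewrite indicI/= mulrA.
rewrite Ex_sum => [|x _]; last by apply: dZ; apply: measurableI => //; exact/FM/FX.
rewrite mulr_suml; apply: eq_bigr => x _.
rewrite ExZ; last by apply: dI; apply: measurableI => //; exact/FM/FX.
rewrite ExZ; last by apply: dI; exact/FM/FX.
rewrite !Ex_indic//; [|exact/FM/FX|by apply: measurableI => //; exact/FM/FX].
by rewrite ind// fineM ?mulrA// fin_num_measure//; exact/FM/FX.
Qed.

End expectation.

(** * Moments along the process *)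

(** The flag [b] charges [y] only on coordinates where [z] may be nonzero; this is where sparsity
    enters. *)
Lemma young_sparse (R : realType) (c y z : R) (b : bool) : 0 < c ->
  (~~ b -> z = 0) -> `|y| * `|z| <= c^-1 / 2 * (b%:R * y ^+ 2) + c / 2 * (z * z).
Proof.
move=> c0; case: b => [_|/(_ isT) ->]; last first.
  by rewrite normr0 !mulr0 mul0r mulr0 addr0.
rewrite mul1r -expr2 -(real_normK (num_real y)) -(real_normK (num_real z)).
set a := `|_|; set b := `|_|.
have : 0 <= c^-1 * (a - c * b) ^+ 2 by rewrite mulr_ge0 ?sqr_ge0// invr_ge0 ltW.
have -> : c^-1 * (a - c * b) ^+ 2 = c^-1 * a ^+ 2 - 2 * (a * b) + c * b ^+ 2.
  by field; rewrite gt_eqF.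
lra.
Qed.

Section absdot.
Context {R : realType} {d : nat}.
Implicit Types (y z : 'rV[R]_d).

Definition absdot y z : R := \sum_v `|y 0 v| * `|z 0 v|.

Lemma absdotC y z : absdot y z = absdot z y.
Proof. by apply: eq_bigr => v _; rewrite mulrC. Qed.

Lemma absdotxx y : absdot y y = dot y y.
Proof. by apply: eq_bigr => v _; rewrite -normrM ger0_norm// -expr2 sqr_ge0. Qed.

Lemma dot_le_absdot (I : finType) (Q : pred I) (b : I -> 'rV[R]_d) y z c :
  0 <= c -> (forall v, `|z 0 v| <= c * \sum_(u | Q u) `|b u 0 v|) ->
  dot y z <= c * \sum_(u | Q u) absdot (b u) y.
Proof.
move=> c0 H; rewrite exchange_big/= mulr_sumr; apply: ler_sum => v _.
apply: (le_trans (ler_norm _)); rewrite normrM mulrC -mulr_suml mulrA.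
by rewrite ler_wpM2r.
Qed.

Lemma dot_sqr_le_absdot (I : finType) (Q : pred I) (b : I -> 'rV[R]_d) z c :
  0 <= c -> (forall v, `|z 0 v| <= c * \sum_(u | Q u) `|b u 0 v|) ->
  dot z z <= c ^+ 2 * \sum_(u | Q u) \sum_(u' | Q u') absdot (b u) (b u').
Proof.
move=> c0 H; under eq_bigr do rewrite exchange_big/=.
rewrite exchange_big/= mulr_sumr; apply: ler_sum => v _.
under [X in _ <= _ * X]eq_bigr do rewrite -mulr_sumr.
rewrite -mulr_suml -2!expr2 -exprMn -(real_normK (num_real (z 0 v))).
by rewrite ler_pXn2r// nnegrE; exact: le_trans (H v).
Qed.

End absdot.

Section process.
Context {R : realType} {d n : nat} (f : 'I_n -> 'rV[R]_d -> R) (gamma : R).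
Context (x0 : 'rV[R]_d) (alpha0 : 'I_n -> 'rV[R]_d) (tau : nat).
Context {disp : measure_display} {T : measurableType disp} (P : probability T R).
Context (xhat : nat -> T -> 'rV[R]_d) (ahat : nat -> T -> 'I_n -> 'rV[R]_d).
Context (idx : nat -> T -> 'I_n).
Hypothesis n_gt0 : (0 < n)%N.
Hypothesis gamma_ge0 : 0 <= gamma.
Hypothesis alpha0_supp : forall i v, v \notin supp f i -> alpha0 i 0 v = 0.
Hypothesis AP : asaga_process f gamma x0 alpha0 tau P xhat ahat idx.

Let F t := past xhat ahat idx t.
(** The direction iteration [u] would take with index [i]: it is determined by read [u] alone,
    whereas [g u] also depends on the sample. *)
Let dirw i u w : 'rV[R]_d := asaga_dir f (xhat u w) (ahat u w) i.
Let g u w : 'rV[R]_d := dirw (idx u w) u w.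
Let x t w : 'rV[R]_d := x0 - gamma *: \sum_(u < t) g u w.
Let q : R := 1 - n%:R^-1.

Let nR : n%:R != 0 :> R. Proof. by rewrite pnatr_eq0 -lt0n. Qed.

Lemma past_sigma t : sigma_algebra [set: T] (F t).
Proof. exact: smallest_sigma_algebra. Qed.

Lemma past_measurable t : F t `<=` @measurable _ T.
Proof.
apply: smallest_sub; first exact: sigma_algebra_measurable.
move=> A [[[u [v [B [_ mB ->]]]]|[u [j [v [B [_ mB ->]]]]]]|[u [i [_ ->]]]].
- by rewrite -[X in measurable X]setTI; exact: (measurable_xhat AP).
- by rewrite -[X in measurable X]setTI; exact: (measurable_ahat AP).
- exact: (measurable_idx AP).
Qed.

Lemma past_subset t r : (t <= r)%N -> F t `<=` F r.
Proof.
move=> tr; apply: sub_sigma_algebra2.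
move=> A [[[u [v [B [ut mB ->]]]]|[u [j [v [B [ut mB ->]]]]]]|[u [i [ut ->]]]].
- by left; left; exists u, v, B; split => //; exact: leq_trans tr.
- by left; right; exists u, j, v, B; split => //; exact: leq_trans tr.
- by right; exists u, i; split => //; exact: leq_trans tr.
Qed.

Definition observable t (U : Type) (X : T -> U) := discrete_wrt (F t) X.

Lemma observable_rv t (U : Type) (X : T -> U) : observable t X -> discrete_rv X.
Proof. exact: sub_discrete (@past_measurable t). Qed.

Lemma observable_le t r (U : Type) (X : T -> U) : (t <= r)%N ->
  observable t X -> observable r X.
Proof. by move=> tr; apply: sub_discrete; exact: past_subset. Qed.

Lemma observable_idx u t : (u < t)%N -> observable t (idx u).
Proof.
move=> ut; split=> [|i]; first exact: finite_finset.
by apply: sub_sigma_algebra; right; exists u, i.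
Qed.

Lemma discrete_row (Fs : set (set T)) (X : T -> 'rV[R]_d) :
  sigma_algebra [set: T] Fs -> (forall v, discrete_wrt Fs (fun w => X w 0 v)) ->
  discrete_wrt Fs X.
Proof.
move=> sF dX; rewrite (_ : X = fun w => \sum_v X w 0 v *: delta_mx 0 v).
  apply: discrete_sum => // v _.
  exact: (discrete_comp sF (fun c : R => c *: delta_mx 0 v) (dX v)).
by apply/funext => w; rewrite -row_sum_delta.
Qed.

(** [Fs] is general because the construction is used twice: over the power set for finite ranges,
    and over the past for observability. *)
Lemma discrete_dirw (Fs : set (set T)) i u : sigma_algebra [set: T] Fs ->
  discrete_wrt Fs (xhat u) -> (forall k, discrete_wrt Fs (fun w => ahat u w k)) ->
  discrete_wrt Fs (dirw i u).
Proof.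
move=> sF dx da; rewrite /dirw /asaga_dir.
apply: (discrete_comp2 sF (fun a b : 'rV[R]_d => a + b)).
  by apply: (discrete_comp2 sF (fun a b => grad (f i) a - b)).
apply: (discrete_comp sF (fun a => (n%:R^-1 *: a) *m Dimx f i)).
exact: discrete_sum.
Qed.

Lemma discrete_g (Fs : set (set T)) u : sigma_algebra [set: T] Fs ->
  discrete_wrt Fs (xhat u) -> (forall k, discrete_wrt Fs (fun w => ahat u w k)) ->
  discrete_wrt Fs (idx u) -> discrete_wrt Fs (g u).
Proof.
move=> sF dx da di; rewrite (_ : g u = fun w => \sum_i (idx u w == i)%:R *: dirw i u w).
  apply: discrete_sum => // i _.
  apply: (discrete_comp2 sF (fun j (a : 'rV[R]_d) => (j == i)%:R *: a)) => //.
  exact: discrete_dirw.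
apply/funext => w; rewrite (bigD1 (idx u w))//= eqxx scale1r big1 ?addr0// => i.
by rewrite eq_sym => /negbTE ->; rewrite scale0r.
Qed.

Let allsets_sigma : sigma_algebra [set: T] [set: set T].
Proof. by split. Qed.

(* Over the power set, being discrete only means having a finite range. *)
Let finite_discrete (U : Type) (X : T -> U) : finite_set (range X) ->
  discrete_wrt [set: set T] X.
Proof. by split. Qed.

(** By strong induction, a coordinate of [xhat t] is a function of finitely many earlier directions
    and Boolean visibility flags, and a memory entry is an initial value or a gradient at an earlier
    read. The flags come from schedules picked by [choice], so only finiteness is obtained; the
    level sets are measurable by the generators of [past]. *)
Lemma finite_reads t : discrete_wrt [set: set T] (xhat t) /\
  forall j, discrete_wrt [set: set T] (fun w => ahat t w j).
Proof.
elim/ltn_ind: t => t IH.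
have [s sP] := choice (process_run AP).
split=> [|j]; apply: discrete_row => // v.
  rewrite (_ : (fun w => _) = fun w => x0 0 v - \sum_(u < t)
      (xvisible f (idx^~ w) (s w) t v u)%:R * (gamma * g u w 0 v)); last first.
    apply/funext => w; rewrite (run_x (sP w)); congr (_ - _).
    rewrite [LHS]big_mkcond; apply: eq_bigr => u _.
    by case: ifP; rewrite ?mul1r ?mul0r.
  apply: (discrete_comp allsets_sigma (fun y => x0 0 v - y)).
  apply: discrete_sum => // u _.
  apply: (discrete_comp2 allsets_sigma (fun (b : bool) (a : 'rV[R]_d) =>
    b%:R * (gamma * a 0 v))); first by apply: finite_discrete; exact: finite_finset.
  have [dx da] := IH u (ltn_ord u).
  by apply: discrete_g => //; apply: finite_discrete; exact: finite_finset.
apply: finite_discrete; apply: (@sub_finite_set _ _ ([set alpha0 j 0 v] `|`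
    \bigcup_(u in `I_t) range (fun w => grad (f j) (xhat u w) 0 v))).
  move=> _ [w _ <-]; have [[_ ->]|[u [uvis _ ->]]] := run_alpha (sP w) t j v.
    by left.
  by right; exists u; [case/and4P: uvis|exists w].
rewrite finite_setU; split; first exact: finite_set1.
apply: bigcup_finite; first exact: finite_II.
move=> u ut; have [dx _] := IH u ut.
by have [] := discrete_comp allsets_sigma (fun y => grad (f j) y 0 v) dx.
Qed.

Lemma observable_xhat u t : (u <= t)%N -> observable t (xhat u).
Proof.
move=> ut; apply: discrete_row => [|v]; first exact: past_sigma.
have [dx _] := finite_reads u; split.
  by have [] := discrete_comp allsets_sigma (fun y : 'rV[R]_d => y 0 v) dx.
move=> y; apply: sub_sigma_algebra; left; left; exists u, v, [set y].
by split => //; exact: measurable_set1.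
Qed.

Lemma observable_ahat u j t : (u <= t)%N -> observable t (fun w => ahat u w j).
Proof.
move=> ut; apply: discrete_row => [|v]; first exact: past_sigma.
have [_ da] := finite_reads u; split.
  by have [] := discrete_comp allsets_sigma (fun y : 'rV[R]_d => y 0 v) (da j).
move=> y; apply: sub_sigma_algebra; left; right; exists u, j, v, [set y].
by split => //; exact: measurable_set1.
Qed.

Lemma observable_dirw i u t : (u <= t)%N -> observable t (dirw i u).
Proof.
move=> ut; apply: discrete_dirw => [| |k].
- exact: past_sigma.
- exact: observable_xhat.
- exact: observable_ahat.
Qed.

Lemma observable_g u t : (u < t)%N -> observable t (g u).
Proof.
move=> ut; apply: discrete_g => [| |k|].
- exact: past_sigma.
- by apply: observable_xhat; exact: ltnW.
- by apply: observable_ahat; exact: ltnW.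
- exact: observable_idx.
Qed.

Lemma observable_x t r : (t <= r)%N -> observable r (x t).
Proof.
move=> tr; apply: (discrete_comp (past_sigma r) (fun y => x0 - gamma *: y)).
apply: discrete_sum => [|u _]; first exact: past_sigma.
by apply: observable_g; exact: leq_trans (ltn_ord u) tr.
Qed.

Lemma observable_comp t (U V : Type) (phi : U -> V) (X : T -> U) :
  observable t X -> observable t (fun w => phi (X w)).
Proof. exact: (discrete_comp (past_sigma t)). Qed.

Lemma observable_comp2 t (U V W : Type) (phi : U -> V -> W) (X : T -> U) (Y : T -> V) :
  observable t X -> observable t Y -> observable t (fun w => phi (X w) (Y w)).
Proof. exact: (discrete_comp2 (past_sigma t)). Qed.

Lemma observable_rvZ t c (X : T -> R) : observable t X ->
  discrete_rv (fun w => c * X w).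
Proof. by move=> oX; exact: observable_rv (observable_comp ( *%R c) oX). Qed.

Lemma observable_sum t (V : nmodType) (I : Type) (r : seq I) (Q : pred I)
    (X : I -> T -> V) : (forall i, Q i -> observable t (X i)) ->
  observable t (fun w => \sum_(i <- r | Q i) X i w).
Proof. exact: (discrete_sum (past_sigma t)). Qed.

Lemma Ex_indicator t i (X : T -> R) : observable t X ->
  Ex P (fun w => X w * (idx t w == i)%:R) = n%:R^-1 * Ex P X.
Proof.
move=> oX; have := Ex_independent (past_sigma t) (@past_measurable t)
  (measurable_idx AP t i) (fun A FA => independent_idx AP i FA) oX.
rewrite (uniform_idx AP) /= mulrC => <-; congr Ex; apply/funext => w.
rewrite indicE; congr (_ * _%:R).
have [e|e] := eqVneq (idx t w) i; first by rewrite mem_set.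
by rewrite memNset//=; exact/eqP.
Qed.

(** Splitting on the value of [idx t], which is uniform and independent of each [X i]; this plays
    the role of conditioning on the past of read [t]. *)
Lemma Ex_sampled t (X : 'I_n -> T -> R) : (forall i, observable t (X i)) ->
  Ex P (fun w => X (idx t w) w) = n%:R^-1 * \sum_i Ex P (X i).
Proof.
move=> oX; rewrite mulr_sumr.
under [RHS]eq_bigr => i _ do rewrite -(Ex_indicator i (oX i)).
rewrite -Ex_sum => [|i _].
  congr Ex; apply/funext => w; rewrite (bigD1 (idx t w))//= eqxx mulr1.
  by rewrite big1 ?addr0// => i; rewrite eq_sym => /negbTE ->; rewrite mulr0.
apply: (@observable_rv t.+1).
apply: (observable_comp2 (fun (a : R) j => a * (j == i)%:R)).
  by apply: observable_le (oX i).
exact: observable_idx.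
Qed.

Lemma observable_unsampled r j k : observable (r + k) (fun w => unsampled (idx^~ w) j r k : R).
Proof.
apply: (discrete_prod (past_sigma _)) => m.
apply: (observable_comp (fun i => (i != j)%:R : R)).
by apply: observable_idx; rewrite ltn_add2l.
Qed.

(** The last factor is 1 minus the indicator that iteration [r + k] draws [j], independent of all
    that precedes, so each factor contributes [q]. *)
Lemma Ex_unsampled r j k (X : T -> R) : observable r X ->
  Ex P (fun w => X w * unsampled (idx^~ w) j r k) = q ^+ k * Ex P X.
Proof.
move=> oX; elim: k => [|k IH].
  by rewrite expr0 mul1r; congr Ex; apply/funext => w; rewrite /unsampled big_ord0 mulr1.
rewrite exprS -mulrA -IH /q mulrBl mul1r -(@Ex_indicator (r + k) j); last first.
  apply: (observable_comp2 (fun a b : R => a * b)); last exact: observable_unsampled.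
  by apply: observable_le oX; exact: leq_addr.
have oY : observable (r + k) (fun w => X w * unsampled (idx^~ w) j r k).
  apply: (observable_comp2 (fun a b : R => a * b)); last exact: observable_unsampled.
  by apply: observable_le oX; exact: leq_addr.
rewrite -ExB.
- congr Ex; apply/funext => w; rewrite /unsampled big_ord_recr/=.
  by case: (_ == j); rewrite /= ?mulr1 ?mulr0 ?subrr ?subr0.
- exact: observable_rv oY.
- apply: (@observable_rv (r + k).+1).
  apply: (observable_comp2 (fun (a : R) i => a * (i == j)%:R)).
    exact: observable_le oY.
  exact: observable_idx.
Qed.


(** * Moment bounds for the directions and the delays *)

Context (L mu : R) (xs : 'rV[R]_d).
Hypothesis d_gt0 : (0 < d)%N.
Hypothesis f_convex : forall i, convex_function [set: 'rV[R]_d] (f i).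
Hypothesis f_diff : forall i y, differentiable (f i) y.
Hypothesis f_lip : forall i, lipschitz_grad L (f i).
Hypothesis mu_gt0 : 0 < mu.
Hypothesis f_strong : strongly_convex mu (fmean f).
Hypothesis xs_min : forall y, fmean f xs <= fmean f y.

Let A : R := Num.sqrt (Delta f).
Let aa t := Ex P (fun w => dot (x t w - xs) (x t w - xs)).
Let e t := Ex P (fun w => fmean f (xhat t w) - fmean f xs).
Let G t := Ex P (fun w => dot (g t w) (g t w)).

Let D_gt0 : 0 < Delta f. Proof. exact: Delta_gt0 f_strong. Qed.
Let A_gt0 : 0 < A. Proof. by rewrite sqrtr_gt0. Qed.
Let L_gt0 : 0 < L. Proof. exact: lipschitz_const_gt0 f_strong. Qed.
Let gs0 : \sum_i grad (f i) xs = 0. 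
Proof. exact: (@sum_grad_min _ _ _ f L mu). Qed.

Let memory_supp t w i v : v \notin supp f i -> ahat t w i 0 v = 0.
Proof. by have [s sP] := process_run AP w; exact: (memory_notin_supp _ sP). Qed.

Let G_ge0 t : 0 <= G t. Proof. by apply: Ex_ge0 => w; exact: dot_ge0. Qed.
Let aa_ge0 t : 0 <= aa t. Proof. by apply: Ex_ge0 => w; exact: dot_ge0. Qed.
Let e_ge0 t : 0 <= e t. Proof. by apply: Ex_ge0 => w; rewrite subr_ge0. Qed.

Lemma Ex_dir_inner t (y : T -> 'rV[R]_d) : observable t y ->
  Ex P (fun w => dot (g t w) (y w)) =
  Ex P (fun w => dot (n%:R^-1 *: \sum_i grad (f i) (xhat t w)) (y w)).
Proof.
move=> oy; have oX i : observable t (fun w => dot (dirw i t w) (y w)).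
  by apply: (observable_comp2 dot) => //; exact: observable_dirw.
rewrite (Ex_sampled oX) -Ex_sum => [|i _]; last exact: observable_rv (oX i).
rewrite -ExZ; last first.
  by apply: (@observable_rv t); apply: observable_sum => i _; exact: oX.
congr Ex; apply/funext => w; rewrite -dot_suml -dotZl; congr (dot (_ *: _) _).
by rewrite sum_asaga_dir//; exact: memory_supp.
Qed.

(** Since [g t] lives on the support of index [idx t], only the part [h (idx t)] of the squared norm
    of [g u] is charged. Averaging over the index weights coordinate [v] by
    [p_v <= Delta f = A ^ 2]; Young's weight [A] then balances both terms at [A / 2]. *)
Lemma cross_moment u t : (u < t)%N ->
  Ex P (fun w => absdot (g u w) (g t w)) <= A / 2 * (G u + G t).
Proof.
move=> ut; have og := observable_g ut.
pose h i w := \sum_v (v \in supp f i)%:R * (g u w 0 v) ^+ 2.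
have oh i : observable t (h i).
  by apply: (observable_comp (fun y : 'rV[R]_d =>
    \sum_v (v \in supp f i)%:R * y 0 v ^+ 2)).
have ohi : observable t.+1 (fun w => h (idx t w) w).
  apply: (observable_comp2 (fun i (y : 'rV[R]_d) =>
    \sum_v (v \in supp f i)%:R * y 0 v ^+ 2)); first exact: observable_idx.
  exact: observable_le og.
have ogg : observable t (fun w => dot (g u w) (g u w)).
  exact: (observable_comp2 dot).
have ogt : observable t.+1 (fun w => dot (g t w) (g t w)).
  by apply: (observable_comp2 dot); exact: observable_g.
have Eh : Ex P (fun w => h (idx t w) w) <= A ^+ 2 * G u.
  rewrite (Ex_sampled oh) -Ex_sum => [|i _]; last exact: observable_rv (oh i).
  have os : observable t (fun w => \sum_i h i w).
    by apply: observable_sum => i _; exact: oh.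
  rewrite -ExZ; last exact: observable_rv os.
  rewrite sqr_sqrtr ?(ltW D_gt0)// -ExZ; last exact: observable_rv ogg.
  apply: Ex_le => [||w].
  - exact: (observable_rvZ _ os).
  - exact: (observable_rvZ _ ogg).
  rewrite /h exchange_big/= !mulr_sumr; apply: ler_sum => v _.
  rewrite -mulr_suml mulrA -pvE -expr2 ler_wpM2r ?sqr_ge0//.
  exact: pv_le_Delta.
apply: (@le_trans _ _ (Ex P (fun w =>
    A^-1 / 2 * h (idx t w) w + A / 2 * dot (g t w) (g t w)))).
  apply: Ex_le => [||w].
  - apply: (@observable_rv t.+1); apply: (observable_comp2 absdot).
      exact: observable_le og.
    exact: observable_g.
  - apply: (@observable_rv t.+1).
    by apply: (observable_comp2 (fun a b : R => A^-1 / 2 * a + A / 2 * b)).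
  rewrite 2!mulr_sumr -big_split/=; apply: ler_sum => v _.
  apply: young_sparse => // vS; have [s sP] := process_run AP w.
  exact: (dir_notin_supp alpha0_supp sP vS).
rewrite ExD.
- rewrite (ExZ P (A^-1 / 2) (observable_rv ohi)) (ExZ P (A / 2) (observable_rv ogt)).
  rewrite mulrDr lerD2r -mulrA mulrCA; apply: le_trans.
    by apply: ler_wpM2l Eh; rewrite ?mulr_ge0 ?invr_ge0 ?ltW.
  by rewrite le_eqVlt; apply/orP; left; apply/eqP; field; rewrite gt_eqF.
- exact: (observable_rvZ _ ohi).
- exact: (observable_rvZ _ ogt).
Qed.

Let win t (u : nat) := (t <= u + tau)%N.
Let S t := \sum_(u < t | win t u) G u.

Let card_win t : \sum_(u < t | win t u) 1 <= tau%:R :> R.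
Proof.
rewrite big_mkcond/= (eq_bigr (fun u : 'I_t => (win t u)%:R)) => [|u _]; last first.
  by case: ifP.
rewrite -natr_sum ler_nat (reindex_inj rev_ord_inj)/=.
rewrite (eq_bigr (fun u : 'I_t => (u < tau)%N : nat)) => [|u _]; first exact: sum_window.
by rewrite /win; congr nat_of_bool; have := ltn_ord u; lia.
Qed.

Let S_ge0 t : 0 <= S t. Proof. by apply: sumr_ge0 => u _; exact: G_ge0. Qed.

Let delay w t v : `|xhat t w 0 v - x t w 0 v| <=
  gamma * \sum_(u < t | win t u) `|g u w 0 v|.
Proof. by have [s sP] := process_run AP w; exact: (read_delay _ alpha0_supp sP). Qed.

Let observable_delay t : observable t (fun w => xhat t w - x t w).
Proof.
apply: (observable_comp2 (fun a b : 'rV[R]_d => a - b)).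
  exact: observable_xhat.
exact: observable_x.
Qed.

Let observable_absdot u t r : (u < r)%N -> (t < r)%N ->
  observable r (fun w => absdot (g u w) (g t w)).
Proof. by move=> ur tr; apply: (observable_comp2 absdot); exact: observable_g. Qed.

Lemma delay_inner t : Ex P (fun w => dot (g t w) (xhat t w - x t w)) <=
  gamma * (A / 2) * (S t + tau%:R * G t).
Proof.
have oad (u : 'I_t) : observable t.+1 (fun w => absdot (g u w) (g t w)).
  by apply: observable_absdot => //; exact: ltnW (ltn_ord u).
have osum : observable t.+1 (fun w => \sum_(u < t | win t u) absdot (g u w) (g t w)).
  by apply: observable_sum.
apply: (@le_trans _ _ (Ex P (fun w => gamma * \sum_(u < t | win t u) absdot (g u w) (g t w)))).
  apply: Ex_le => [||w].
  - apply: (@observable_rv t.+1); apply: (observable_comp2 dot).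
      exact: observable_g.
    exact: observable_le (observable_delay t).
  - exact: (observable_rvZ _ osum).
  by apply: dot_le_absdot => // v; have := delay w t v; rewrite !mxE.
rewrite ExZ; last exact: observable_rv osum.
rewrite Ex_sum; last by move=> u _; exact: observable_rv (oad u).
rewrite -mulrA ler_wpM2l//.
apply: (@le_trans _ _ (\sum_(u < t | win t u) A / 2 * (G u + 1 * G t))).
  by apply: ler_sum => u _; rewrite mul1r; apply: cross_moment.
rewrite -mulr_sumr big_split/= -/(S t) -mulr_suml.
rewrite ler_wpM2l ?divr_ge0 ?(ltW A_gt0)// lerD2l ler_wpM2r//.
exact: card_win.
Qed.

(** The diagonal pairs give [S t]; the others, ordered so that [cross_moment] applies, give at most
    [tau * A * S t]. *)
Lemma delay_sqr t : Ex P (fun w => dot (xhat t w - x t w) (xhat t w - x t w)) <=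
  gamma ^+ 2 * (1 + tau%:R * A) * S t.
Proof.
have oad (u v : 'I_t) : observable t (fun w => absdot (g u w) (g v w)).
  by apply: observable_absdot.
have osum1 (u : 'I_t) : observable t (fun w =>
    \sum_(v < t | win t v) absdot (g u w) (g v w)).
  by apply: observable_sum => v _.
have osum : observable t (fun w =>
    \sum_(u < t | win t u) \sum_(v < t | win t v) absdot (g u w) (g v w)).
  by apply: observable_sum => v _.
apply: (@le_trans _ _ (Ex P (fun w => gamma ^+ 2 *
    \sum_(u < t | win t u) \sum_(v < t | win t v) absdot (g u w) (g v w)))).
  apply: Ex_le => [||w].
  - apply: (@observable_rv t); apply: (observable_comp2 dot); exact: observable_delay.
  - exact: (observable_rvZ _ osum).
  by apply: dot_sqr_le_absdot => // v; have := delay w t v; rewrite !mxE.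
rewrite ExZ; last exact: observable_rv osum.
rewrite -mulrA ler_wpM2l ?sqr_ge0//.
rewrite Ex_sum; last by move=> u _; exact: observable_rv (osum1 u).
have cr (u v : 'I_t) : Ex P (fun w => absdot (g u w) (g v w)) <=
    (u == v)%:R * G u + A / 2 * (G u + G v).
  have [<-|uv] := eqVneq u v.
    under eq_fun do rewrite absdotxx.
    by rewrite mul1r lerDl mulr_ge0 ?addr_ge0 ?divr_ge0 ?(ltW A_gt0).
  rewrite mul0r add0r; have [ltuv|] := ltnP u v; first exact: cross_moment.
  rewrite leq_eqVlt eq_sym => /predU1P[uv'|ltvu]; first by move/eqP: uv; case; exact/val_inj.
  rewrite (_ : (fun w => _) = fun w => absdot (g v w) (g u w)); last first.
    by apply/funext => w; exact: absdotC.
  by rewrite [G u + _]addrC; exact: cross_moment.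
apply: (@le_trans _ _ (\sum_(u < t | win t u) (G u + A / 2 * (tau%:R * G u + S t)))).
  apply: ler_sum => u wu; rewrite Ex_sum; last by move=> v _; exact: observable_rv (oad u v).
  apply: (@le_trans _ _ (\sum_(v < t | win t v) ((u == v)%:R * G u + A / 2 * (1 * G u + G v)))).
    by apply: ler_sum => v _; rewrite mul1r; exact: cr.
  rewrite big_split/= -!mulr_suml -mulr_sumr big_split/= -mulr_suml -/(S t); apply: lerD.
    rewrite (bigD1 u)//= eqxx big1 ?addr0 ?mul1r// => v /andP[_].
    by rewrite eq_sym => /negbTE ->.
  rewrite ler_wpM2l ?divr_ge0 ?(ltW A_gt0)// lerD2r ler_wpM2r//.
  exact: card_win.
rewrite big_split/= -/(S t) -mulr_sumr big_split/= -mulr_sumr -/(S t).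
have -> : \sum_(u < t | win t u) S t = (\sum_(u < t | win t u) 1) * S t.
  by rewrite mulr_suml; apply: eq_bigr => u _; rewrite mul1r.
set c := \sum_(u < t | _) _.
have cS : c * S t <= tau%:R * S t by rewrite ler_wpM2r// /c; exact: card_win.
have := ler_wpM2l (ltW A_gt0) cS; lra.
Qed.

(** The inner product is split at [xhat t], where the direction is unbiased. Strong convexity
    contracts the distance from [xhat t]; passing to the distance from [x t] halves the contraction
    and costs [gamma * mu] times the squared delay. *)
Lemma iterate_recursion t : aa t.+1 <= (1 - gamma * mu / 2) * aa t - 2 * gamma * e t
  + gamma ^+ 2 * (1 + tau%:R * A) * G t
  + gamma ^+ 2 * (A + gamma * mu * (1 + tau%:R * A)) * S t.
Proof.
pose xt w := x t w - xs; pose hx w := xhat t w - xs; pose dl w := xhat t w - x t w.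
have oxt : observable t xt.
  by apply: (observable_comp (fun y => y - xs)); exact: observable_x.
have ohx : observable t hx.
  by apply: (observable_comp (fun y => y - xs)); exact: observable_xhat.
have odl : observable t dl by exact: observable_delay.
have og : observable t.+1 (g t) by exact: observable_g.
have rvdot r (y z : T -> 'rV[R]_d) : observable r y -> observable r z ->
    discrete_rv (fun w => dot (y w) (z w)).
  by move=> oy oz; apply: (@observable_rv r); exact: (observable_comp2 dot).
have rvZ c (X : T -> R) : discrete_rv X -> discrete_rv (fun w => c * X w).
  move=> oX; exact: (discrete_comp (sigma_algebra_measurable T) ( *%R c) oX).
have rvD (X Y : T -> R) : discrete_rv X -> discrete_rv Y ->
    discrete_rv (fun w => X w + Y w).
  move=> oX oY.
  exact: (discrete_comp2 (sigma_algebra_measurable T) (fun a b : R => a + b) oX oY).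
have oS (y : T -> 'rV[R]_d) : observable t y -> observable t.+1 y.
  exact: observable_le.
have gh := rvdot _ _ _ og (oS _ ohx); have gd := rvdot _ _ _ og (oS _ odl).
have gg := rvdot _ _ _ og og; have xx := rvdot _ _ _ oxt oxt.
have hh := rvdot _ _ _ ohx ohx; have dd := rvdot _ _ _ odl odl.
have oe : discrete_rv (fun w => fmean f (xhat t w) - fmean f xs).
  apply: (@observable_rv t).
  by apply: (observable_comp (fun y => fmean f y - fmean f xs)); exact: observable_xhat.
have E1 : aa t.+1 = aa t + (- (2 * gamma)) * Ex P (fun w => dot (g t w) (hx w))
    + (2 * gamma) * Ex P (fun w => dot (g t w) (dl w)) + gamma ^+ 2 * G t.
  rewrite /aa /G -(ExZ P _ gh) -(ExZ P _ gd) -(ExZ P _ gg) -(ExD P xx (rvZ _ _ gh)).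
  rewrite -(ExD P (rvD _ _ xx (rvZ _ _ gh)) (rvZ _ _ gd)).
  rewrite -(ExD P (rvD _ _ (rvD _ _ xx (rvZ _ _ gh)) (rvZ _ _ gd)) (rvZ _ _ gg)).
  congr Ex; apply/funext => w.
  have -> : x t.+1 w - xs = xt w - gamma *: g t w.
    rewrite (_ : x t.+1 w = x t w - gamma *: g t w); last first.
      by rewrite /x big_ord_recr/= scalerDr opprD addrA.
    rewrite /xt; move: (x t w) (g t w) => a b.
    by rewrite addrAC.
  have -> : hx w = xt w + dl w.
    rewrite /hx /xt /dl; move: (xhat t w) (x t w) => a b.
    by rewrite [RHS]addrC addrA subrK.
  move: (xt w) (dl w) (g t w) => a b c.
  by rewrite !dotE [dot c a]dotC; ring.
have E2 : e t + mu / 2 * Ex P (fun w => dot (hx w) (hx w)) <=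
    Ex P (fun w => dot (g t w) (hx w)).
  rewrite Ex_dir_inner// -(ExZ P _ hh) -(ExD P oe (rvZ _ _ hh)).
  apply: Ex_le => [||w].
  - by apply: rvD => //; exact: rvZ.
  - apply: (rvdot t) => //; apply: (observable_comp (fun y => n%:R^-1 *: \sum_i grad (f i) y)).
    exact: observable_xhat.
  exact: mean_grad_inner.
have E3 : aa t <= 2 * Ex P (fun w => dot (hx w) (hx w))
    + 2 * Ex P (fun w => dot (dl w) (dl w)).
  rewrite -(ExZ P _ hh) -(ExZ P _ dd) -(ExD P (rvZ _ _ hh) (rvZ _ _ dd)).
  apply: Ex_le => [||w] //; first by apply: rvD; exact: rvZ.
  have -> : x t w - xs = hx w - dl w.
    rewrite /hx /dl; move: (xhat t w) (x t w) => a b.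
    by rewrite opprB [RHS]addrC addrA subrK.
  move: (hx w) (dl w) => a b.
  rewrite -subr_ge0; apply: le_trans (dot_ge0 (a + b)) _.
  by rewrite !dotE [dot b a]dotC le_eqVlt; apply/orP; left; apply/eqP; ring.
have E4 : Ex P (fun w => dot (g t w) (dl w)) <=
  gamma * (A / 2) * (S t + tau%:R * G t) := delay_inner t.
have E5 : Ex P (fun w => dot (dl w) (dl w)) <=
  gamma ^+ 2 * (1 + tau%:R * A) * S t := delay_sqr t.
rewrite E1 {E1}; move: E2 E3 E4 E5.
set EH := Ex P (fun w => dot (g t w) (hx w)).
set HH := Ex P (fun w => dot (hx w) (hx w)).
set GD := Ex P (fun w => dot (g t w) (dl w)).
set DD := Ex P (fun w => dot (dl w) (dl w)) => E2 E3 E4 E5.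
have F2 := ler_wpM2l gamma_ge0 E2; have F4 := ler_wpM2l gamma_ge0 E4.
have gm : 0 <= gamma * mu by rewrite mulr_ge0// ltW.
have F3 := ler_wpM2l gm E3; have F5 := ler_wpM2l gm E5.
move: (aa t) (e t) (G t) (S t) F2 F3 F4 F5.
move=> {E2 E3 E4 E5} at_ et Gt St F2 F3 F4 F5; lra.
Qed.

(** Initial memory error on the scale of a suboptimality: the factor [2 * L] is that of
    [mean_cocoercivity]. *)
Let e0 : R := (2 * L)^-1 * (n%:R^-1 * \sum_i dot (alpha0 i - grad (f i) xs) (alpha0 i - grad (f i) xs)).

(** [memory_bound] is taken in expectation. A value written by [u] counts with [1/n] for drawing [j]
    at [u] and with [q] for each later draw in the window that avoids [j]; its error [D u j] is
    known before the window starts. *)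
Lemma direction_moment t : G t <= 4 * L * e t
  + 4 * L / n%:R * \sum_(u < t) q ^+ (t - 2 * tau - u - 1) * e u
  + 4 * L * q ^+ (t - tau) * e0.
Proof.
pose D u j w := dot (grad (f j) (xhat u w) - grad (f j) xs) (grad (f j) (xhat u w) - grad (f j) xs).
pose M j w := dot (ahat t w j - grad (f j) xs) (ahat t w j - grad (f j) xs).
pose d0 j := dot (alpha0 j - grad (f j) xs) (alpha0 j - grad (f j) xs).
have oD u r j : (u <= r)%N -> observable r (D u j).
  move=> ur; apply: (observable_comp (fun y => dot (grad (f j) y - grad (f j) xs)
    (grad (f j) y - grad (f j) xs))); exact: observable_xhat.
have oM j : observable t (M j).
  apply: (observable_comp (fun y => dot (y - grad (f j) xs) (y - grad (f j) xs))).
  exact: observable_ahat.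
have n0 : 0 <= n%:R^-1 :> R by rewrite invr_ge0.
have meanD u : n%:R^-1 * \sum_j Ex P (D u j) <= 2 * L * e u.
  rewrite -Ex_sum => [|j _]; last exact: observable_rv (oD u u j (leqnn u)).
  have os : observable u (fun w => \sum_j D u j w).
    by apply: observable_sum => j _; exact: oD.
  have oe : observable u (fun w => fmean f (xhat u w) - fmean f xs).
    by apply: (observable_comp (fun y => fmean f y - fmean f xs)); exact: observable_xhat.
  rewrite -ExZ; last exact: observable_rv os.
  rewrite -ExZ; last exact: observable_rv oe.
  apply: Ex_le => [||w].
  - exact: (observable_rvZ _ os).
  - exact: (observable_rvZ _ oe).
  exact: (@mean_cocoercivity _ _ _ f L mu).
have odd i : observable t (fun w => dot (dirw i t w) (dirw i t w)).
  by apply: (observable_comp2 dot); exact: observable_dirw.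
have H1 : G t <= 2 * (n%:R^-1 * \sum_j Ex P (D t j)) + 2 * (n%:R^-1 * \sum_j Ex P (M j)).
  rewrite /G (Ex_sampled odd) mulrCA [X in _ + X]mulrCA -mulrDr ler_wpM2l//.
  rewrite -!Ex_sum; try by move=> j _; apply: (@observable_rv t); auto.
  have osD : observable t (fun w => \sum_j D t j w).
    by apply: observable_sum => j _; exact: oD.
  have osM : observable t (fun w => \sum_j M j w) by exact: observable_sum.
  rewrite -!ExZ; [|exact: observable_rv osM|exact: observable_rv osD].
  have os2 (X : T -> R) : observable t X -> discrete_rv (fun w => 2 * X w).
    by move=> oX; exact: (observable_rvZ 2 oX).
  rewrite -ExD; [|exact: os2|exact: os2].
  apply: Ex_le => [||w].
  - by apply: (@observable_rv t); exact: observable_sum.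
  - by apply: (@observable_rv t); apply: (observable_comp2 (fun a b : R => 2 * a + 2 * b)).
  by apply: sum_asaga_dir_sqr => //; exact: memory_supp.
have H2 j : Ex P (M j) <= \sum_(u < t) q ^+ (t - 2 * tau - u - 1) * (n%:R^-1 * Ex P (D u j))
    + q ^+ (t - tau) * d0 j.
  pose Y (u : 'I_t) w := (D u j w * (idx u w == j)%:R) *
    unsampled (idx^~ w) j (u + tau + 1) (t - 2 * tau - u - 1).
  pose Z w := d0 j * unsampled (idx^~ w) j 0 (t - tau).
  have oDi (u : 'I_t) : observable (u + tau + 1) (fun w => D u j w * (idx u w == j)%:R).
    apply: (observable_comp2 (fun (a : R) i => a * (i == j)%:R)); first by apply: oD; lia.
    by apply: observable_idx; lia.
  (* An empty window still starts at [u + tau + 1], which may exceed [t]; hence the late observation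
     time. *)
  have oY (u : 'I_t) : observable (t + tau + 1) (Y u).
    have ut := ltn_ord u; apply: (observable_comp2 (fun a b : R => a * b)).
      by apply: observable_le (oDi u); lia.
    by apply: observable_le (observable_unsampled _ _ _); lia.
  have oZ : observable t Z.
    apply: (observable_comp (fun y : R => d0 j * y)).
    by apply: observable_le (observable_unsampled 0 j (t - tau)); lia.
  apply: (@le_trans _ _ (Ex P (fun w => \sum_(u < t) Y u w + Z w))).
    apply: Ex_le => [||w].
    - exact: observable_rv (oM j).
    - apply: (@observable_rv (t + tau + 1)); apply: (observable_comp2 (fun a b : R => a + b)).
        exact: observable_sum.
      by apply: observable_le oZ; lia.
    have [s sP] := process_run AP w.
    have := memory_bound gamma_ge0 alpha0_supp sP t (fun v => @grad_notin_supp _ _ _ f j xs v).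
    rewrite -/(M j w) -/(d0 j) => /le_trans; apply; rewrite [_ * d0 j]mulrC lerD2r.
    by apply: ler_sum => u _; rewrite /Y mulrC mulrA.
  rewrite ExD; last 2 first.
  - by apply: (@observable_rv (t + tau + 1)); exact: observable_sum.
  - exact: observable_rv oZ.
  rewrite Ex_sum => [|u _]; last exact: observable_rv (oY u).
  rewrite Ex_unsampled; last exact: (discrete_cst (past_sigma 0)).
  rewrite Ex_cst lerD2r; apply: ler_sum => u _.
  by rewrite Ex_unsampled// Ex_indicator//; exact: oD.
apply: (le_trans H1).
have -> : 4 * L / n%:R * \sum_(u < t) q ^+ (t - 2 * tau - u - 1) * e u =
    2 * \sum_(u < t) q ^+ (t - 2 * tau - u - 1) * (n%:R^-1 * (2 * L * e u)).
  by rewrite !mulr_sumr; apply: eq_bigr => u _; ring.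
have -> : 4 * L * q ^+ (t - tau) * e0 = 2 * (q ^+ (t - tau) * (n%:R^-1 * \sum_j d0 j)).
  by rewrite /e0; field; rewrite nR gt_eqF.
have -> : 4 * L * e t = 2 * (2 * L * e t) by ring.
rewrite -addrA -[leLHS]mulrDr -[X in _ <= _ + X]mulrDr -[leRHS]mulrDr ler_pM2l//.
apply: lerD; first exact: meanD.
apply: (@le_trans _ _ (n%:R^-1 * \sum_j (\sum_(u < t) q ^+ (t - 2 * tau - u - 1) *
    (n%:R^-1 * Ex P (D u j)) + q ^+ (t - tau) * d0 j))).
  by rewrite ler_wpM2l//; apply: ler_sum => j _; exact: H2.
rewrite big_split/= -mulr_sumr mulrDr [n%:R^-1 * (q ^+ _ * _)]mulrCA lerD2r.
rewrite exchange_big/= mulr_sumr; apply: ler_sum => u _.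
rewrite -mulr_sumr mulrCA ler_wpM2l//; last by rewrite ler_wpM2l// -mulr_sumr.
by rewrite exprn_ge0// subr_ge0 invf_le1 ?ltr0n// ler1n.
Qed.

Lemma expected_suboptimality (rho : R) t : 0 < gamma -> tau%:R < n%:R / 10 :> R ->
  0 <= rho -> rho <= 5^-1 * n%:R^-1 -> rho <= gamma * mu / 2 ->
  gamma * L * (1 + tau%:R * A + 50 / 49 *
    (A + gamma * mu * (1 + tau%:R * A)) * tau%:R) <= 3 / 40 ->
  ('E_P[fun w => fmean f (xhat t w)] - (fmean f xs)%:E <=
   (gamma^-1 * ((1 - rho) ^+ t.+1 * (dot (x0 - xs) (x0 - xs) + gamma * n%:R * e0)))%:E)%E.
Proof.
move=> g0 tau_lt r0 rn rmu st.
have e00 : 0 <= e0.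
  rewrite mulr_ge0 ?invr_ge0 ?mulr_ge0 ?(ltW L_gt0) ?invr_ge0//.
  by apply: sumr_ge0 => i _; exact: dot_ge0.
have of_ : discrete_rv (fun w => fmean f (xhat t w)).
  by apply: (@observable_rv t); apply: (observable_comp (fmean f)); exact: observable_xhat.
have ocst : discrete_rv (fun _ : T => fmean f xs).
  by apply: (@observable_rv 0); exact: (discrete_cst (past_sigma 0)).
rewrite (expectation_Ex P of_) -EFinB lee_fin -[X in _ - X <= _](Ex_cst P).
rewrite -(ExB P of_ ocst) -/(e t).
rewrite ler_pdivlMl//.
have aa0 : aa 0 = dot (x0 - xs) (x0 - xs).
  rewrite /aa -[RHS](Ex_cst P); congr Ex; apply/funext => w.
  by rewrite /x big_ord0 scaler0 subr0.
rewrite -aa0.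
exact: (@recursion_bound R n tau aa e G L mu gamma A e0 rho n_gt0 tau_lt aa_ge0 e_ge0
  G_ge0 e00 L_gt0 mu_gt0 g0 (ltW A_gt0) r0 rn rmu st iterate_recursion direction_moment).
Qed.

End process.

Theorem theorem8 (R : realType) :
  exists K : R, 0 < K /\
  forall (d n : nat) (f : 'I_n -> 'rV[R]_d -> R) (L mu : R) (xs : 'rV[R]_d)
    (x0 : 'rV[R]_d) (alpha0 : 'I_n -> 'rV[R]_d) (tau : nat) (a : R)
    (disp : measure_display) (T : measurableType disp) (P : probability T R)
    (xhat : nat -> T -> 'rV[R]_d) (ahat : nat -> T -> 'I_n -> 'rV[R]_d)
    (idx : nat -> T -> 'I_n),
  let kappa := L / mu in
  let gamma := a / L in
  (0 < d)%N ->
  (forall i, convex_function [set: 'rV[R]_d] (f i)) ->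
  (forall i x, differentiable (f i) x) ->
  (forall i, lipschitz_grad L (f i)) ->
  0 < mu ->
  strongly_convex mu (fmean f) ->
  (forall x, fmean f xs <= fmean f x) ->
  (forall i v, v \notin supp f i -> alpha0 i 0 v = 0) ->
  asaga_process f gamma x0 alpha0 tau P xhat ahat idx ->
  tau%:R < n%:R / 10 :> R ->
  0 < a <= astar kappa (Delta f) tau ->
  exists Ct : R, Ct <= K * (n%:R / gamma * C0 f L xs x0 alpha0) /\
  forall t : nat,
    ('E_P[fun w => fmean f (xhat t w)] - (fmean f xs)%:E <=
     ((1 - rho n kappa a) ^+ t * Ct)%:E)%E.
Proof.
exists 1; split=> // d n f L mu xs x0 alpha0 tau a disp T P xhat ahat idx kappa gamma.
move=> d0 fc fd fl mu0 fs xmin as0 AP tau_lt /[dup] /andP[a0 _] aP.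
have n0 : (0 < n)%N.
  rewrite -(ltr0n R); have : 0 <= tau%:R :> R by []; move: tau_lt; lra.
have nR0 : 0 < n%:R :> R by rewrite ltr0n.
have L0 : 0 < L := lipschitz_const_gt0 d0 fd fl mu0 fs.
have D0 : 0 < Delta f := Delta_gt0 d0 n0 fd mu0 fs.
have k0 : 0 < kappa by rewrite divr_gt0.
have g0 : 0 < gamma by rewrite divr_gt0.
have gmu : gamma * mu = a / kappa by rewrite /gamma /kappa; field; rewrite !gt_eqF.
have gL : gamma * L = a by rewrite /gamma divfK ?gt_eqF.
have ak0 : 0 < a / kappa by rewrite divr_gt0.
have nV0 : 0 < n%:R^-1 :> R by rewrite invr_gt0.
have [a32 step] := astar_step k0 D0 aP.
set r := rho n kappa a.
have mn0 : 0 < Num.min n%:R^-1 (a / kappa) by rewrite lt_min nV0.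
have mn1 : Num.min n%:R^-1 (a / kappa) <= n%:R^-1 by rewrite ge_min lexx.
have mn2 : Num.min n%:R^-1 (a / kappa) <= a / kappa by rewrite ge_min lexx orbT.
have nV1 : n%:R^-1 <= 1 :> R by rewrite invf_le1// ler1n.
(* The recursion yields [gamma^-1] times the initial distance plus [a / 2] of the scaled memory
   error. As [a / 2 <= 1/64 < 1/5] and [n >= 1], this witness dominates it with [K = 1]. *)
exists (n%:R / gamma * C0 f L xs x0 alpha0); split; first by rewrite mul1r.
move=> t; have r0 : 0 <= r by rewrite /r /rho; lra.
have rn : r <= 5^-1 * n%:R^-1 by rewrite /r /rho; lra.
have rmu : r <= gamma * mu / 2 by rewrite gmu /r /rho; lra.
have st : gamma * L * (1 + tau%:R * Num.sqrt (Delta f) + 50 / 49 *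
    (Num.sqrt (Delta f) + gamma * mu * (1 + tau%:R * Num.sqrt (Delta f))) * tau%:R) <= 3 / 40.
  by rewrite gL gmu.
apply: le_trans (expected_suboptimality n0 (ltW g0) as0 AP d0 fc fd fl mu0 fs xmin t
  g0 tau_lt r0 rn rmu st) _.
rewrite lee_fin exprSr /C0 enorm_sqr.
under [X in _ <= _ * (_ * (_ + _ * X))]eq_bigr do rewrite enorm_sqr.
set S := \sum_(i < n) _; set N := dot _ _.
have S0 : 0 <= S by apply: sumr_ge0 => i _; exact: dot_ge0.
have N0 : 0 <= N by exact: dot_ge0.
have rX : 0 <= (1 - r) ^+ t by rewrite exprn_ge0// subr_ge0; lra.
rewrite -mulrA mulrCA ler_wpM2l//.
have -> : n%:R / gamma * (N + (5 * L ^+ 2)^-1 * S) =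
  gamma^-1 * (n%:R * (N + (5 * L ^+ 2)^-1 * S)) by rewrite [n%:R / _]mulrC -mulrA.
rewrite ler_pM2l ?invr_gt0//.
have -> : gamma * n%:R * ((2 * L)^-1 * (n%:R^-1 * S)) = a / 2 * (L ^- 2 * S).
  by rewrite /gamma; field; rewrite !gt_eqF.
have -> : (5 * L ^+ 2)^-1 * S = 5^-1 * (L ^- 2 * S) by rewrite invfM mulrA.
set X := L ^- 2 * S; have X0 : 0 <= X by rewrite mulr_ge0// invr_ge0 sqr_ge0.
have aX : a * X <= 1 / 32 * X by rewrite ler_wpM2r.
apply: (@le_trans _ _ (N + 5^-1 * X)).
  apply: (@le_trans _ _ (1 * (N + a / 2 * X))); last by lra.
  rewrite ler_wpM2r//; last by rewrite gerBl.
  by rewrite addr_ge0// mulr_ge0// divr_ge0// ltW.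
rewrite -[leLHS]mul1r ler_wpM2r ?ler1n// addr_ge0// mulr_ge0//.
Qed.
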